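(* $\textsc{BNSL}^{+}$ is NP-hard. Moreover, for every fixed integer $q\geq 3$, $\textsc{BNSL}^{+}_{\leq}$ restricted to instances with parent-set bound $q$ is NP-hard.
   Context: Let $V$ be a finite set and $\mathcal{F}=\{f_v:2^{V\setminus\{v\}}\to\mathbb{N}_0 : v\in V\}$. For a digraph $D=(V,A)$ let $P_D(v)=\{u:uv\in A\}$ and $\texttt{score}(D)=\sum_v f_v(P_D(v))$. In the additive representation, it is required that $f_v(Q)=\sum_{x\in Q}f_v(\{x\})$ for all $v$ and $Q\subseteq V\setminus\{v\}$, and $\mathcal{F}$ is given by the values $f_v(\{x\})$ for $x\in V\setminus\{v\}$. $\textsc{BNSL}^{+}$: given $V$, $\mathcal{F}$ in the additive representation and an integer $\ell$, decide whether there is an acyclic digraph $D$ on $V$ with $\texttt{score}(D)\geq\ell$. $\textsc{BNSL}^{+}_{\leq}$: additionally an integer $q$ is given, and $D$ must also have every in-degree at most $q$. *)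

(* Defs.v *)
From HB Require Import structures.
From mathcomp Require Import all_boot all_order all_algebra.

Set Implicit Arguments.
Unset Strict Implicit.
Unset Printing Implicit Defensive.

(** * Polynomial time, NP and NP-hardness *)

(** Deterministic multi-tape Turing machines over two-way infinite tapes, with
    at least two tapes.  A cell holds [None] (blank), a bit, or a symbol of the
    machine's own work alphabet. *)

Variant move := MoveL | MoveR | Stay.

Record tm := TM {
  extra_tapes : nat;
  state : finType;
  work : finType;
  start : state;
  halting : pred state;
  accepting : pred state;
  trans : state -> {ffun 'I_extra_tapes.+2 -> option (bool + work)} ->
          state * ('I_extra_tapes.+2 -> option (bool + work) * move)
}.

Definition cell (M : tm) : Type := option (bool + work M).

(** [left_of] lists the cells to the left of the head, nearest first; cells
    beyond either list are blank. *)
Record tape (M : tm) := Tape {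
  left_of : seq (cell M);
  scanned : cell M;
  right_of : seq (cell M)
}.

Definition write_move (M : tm) (a : cell M * move) (t : tape M) : tape M :=
  match a.2 with
  | MoveL => Tape (behead (left_of t)) (head None (left_of t))
                  (a.1 :: right_of t)
  | MoveR => Tape (a.1 :: left_of t) (head None (right_of t))
                  (behead (right_of t))
  | Stay => Tape (left_of t) a.1 (right_of t)
  end.

Definition config (M : tm) : Type :=
  (state M * {ffun 'I_(extra_tapes M).+2 -> tape M})%type.

Definition step (M : tm) (c : config M) : config M :=
  if halting c.1 then c else
  let a := trans c.1 [ffun i => scanned (c.2 i)] in
  (a.1, [ffun i => write_move (a.2 i) (c.2 i)]).

Definition input_tape (M : tm) (x : seq bool) : tape M :=
  let s : seq (cell M) := [seq Some (inl b) | b <- x] in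
  Tape [::] (head None s) (behead s).

(** The [i]-th input is written on tape [i]; the other tapes are blank. *)
Definition init (M : tm) (inputs : seq (seq bool)) : config M :=
  (start M, [ffun i : 'I_(extra_tapes M).+2 =>
               input_tape M (nth [::] inputs i)]).

Definition run (M : tm) (inputs : seq (seq bool)) (t : nat) : config M :=
  iter t (@step M) (init M inputs).

(** The output is the maximal string of bits on tape 0 that starts at the
    head and extends to the right. *)
Fixpoint leading_bits (M : tm) (s : seq (cell M)) : seq bool :=
  if s is Some (inl b) :: s' then b :: leading_bits s' else [::].

Definition output (M : tm) (c : config M) : seq bool :=
  leading_bits (scanned (c.2 ord0) :: right_of (c.2 ord0)).

Definition polytime_fun (f : seq bool -> seq bool) : Prop :=
  exists (M : tm) (p : {poly nat}), forall x : seq bool,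
    let c := run M [:: x] p.[size x]%R in
    halting c.1 /\ output c = f x.

Definition polytime_rel (r : rel (seq bool)) : Prop :=
  exists (M : tm) (p : {poly nat}), forall x w : seq bool,
    let c := run M [:: x; w] p.[size x + size w]%R in
    halting c.1 /\ accepting c.1 = r x w.

Definition language : Type := seq bool -> Prop.

Definition in_NP (L : language) : Prop :=
  exists (r : rel (seq bool)) (p : {poly nat}),
    polytime_rel r /\
    forall x, L x <-> exists2 w, size w <= p.[size x]%R & r x w.

Definition reduces (L L' : language) : Prop :=
  exists f, polytime_fun f /\ forall x, L x <-> L' (f x).

Definition NP_hard (L : language) : Prop :=
  forall L', in_NP L' -> reduces L' L.

(** * Digraphs and local scores *)

Definition parents (V : finType) (D : rel V) (v : V) : {set V} :=
  [set u | D u v].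

Definition acyclic (V : finType) (D : rel V) : Prop :=
  forall c : seq V, cycle D c -> c = [::].

(** [f v Q] matters only for [v \notin Q]; its other values are junk. *)
Definition score (V : finType) (f : V -> {set V} -> nat) (D : rel V) : nat :=
  \sum_(v : V) f v (parents D v).

Definition additive (V : finType) (f : V -> {set V} -> nat) : Prop :=
  forall (v : V) (Q : {set V}), v \notin Q ->
    f v Q = \sum_(x in Q) f v [set x].

(** * Encoding of instances *)

(** Binary digits, least significant first, without leading zeros. *)
Definition binary (n : nat) : seq bool :=
  mkseq (fun i => odd (n %/ 2 ^ i)) (up_log 2 n.+1).

(** Self-delimiting: each digit is preceded by [true], the end is [false]. *)
Definition encode_nat (n : nat) : seq bool :=
  flatten [seq [:: true; b] | b <- binary n] ++ [:: false].

Definition encode_int (z : int) : seq bool :=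
  (z < 0)%R :: encode_nat `|z|%N.

(** Additive representation over [V = {0, ..., n-1}]: [n], then the values
    [f v {x}] for [x != v], then the integer parameters. *)
Definition encode (n : nat) (f : 'I_n -> {set 'I_n} -> nat) (zs : seq int) :
    seq bool :=
  encode_nat n ++
  flatten [seq encode_nat (f v [set x]) | v <- enum 'I_n, x <- enum (predC1 v)]
  ++ flatten [seq encode_int z | z <- zs].

(** * The problems, as languages of encoded yes-instances *)

Definition BNSL_plus : language := fun s =>
  exists (n : nat) (f : 'I_n -> {set 'I_n} -> nat) (l : int),
    [/\ additive f,
        s = encode f [:: l] &
        exists D : rel 'I_n, acyclic D /\ (l <= (score f D)%:Z)%R].

(** Restricted to the instances whose parent-set bound is [q]. *)
Definition BNSL_plus_le (q : int) : language := fun s =>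
  exists (n : nat) (f : 'I_n -> {set 'I_n} -> nat) (l : int),
    [/\ additive f,
        s = encode f [:: l; q] &
        exists D : rel 'I_n,
          [/\ acyclic D,
              forall v, (#|parents D v|%:Z <= q)%R &
              (l <= (score f D)%:Z)%R]].

(* Main.v *)
Require Import Defs.
From Stdlib Require Import FunctionalExtensionality.
From mathcomp Require Import all_boot all_order all_algebra zify.

Set Implicit Arguments.
Unset Strict Implicit.
Unset Printing Implicit Defensive.

(** Cook and Levin's argument turns an NP language into binary constraint
    satisfaction problems: the variables are the places of a computation tableau of
    the verifier, indexed by a time and an offset from the heads, and the constraints
    relate neighbouring places.  Such a problem with [P] variables is solvable iff the
    conflict graph on its [N] pairs (variable, value) has an independent set of size
    [P].  As in Karp's reduction of vertex cover to feedback arc set, every node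
    becomes a directed path and conflicting nodes have their paths joined in both
    directions into a cycle; hence an independent set of size [P] exists iff all but
    [N - P] arcs can be kept without creating a cycle.  Spreading the arcs that enter
    a path over its vertices keeps all in-degrees at most 2, so a bound [q >= 3] on
    the number of parents is harmless.

    The reduction is polynomial-time because its output is given by an expression
    built from bounded sums and for-loops; such expressions are compiled to counter
    programs, and these to multi-tape machines whose head positions are the counters.
    All values and running times stay below [B ^ k], with [B] bounding the input. *)

(** * Turing machine fragments *)

(** Constraints may involve only two variables, whereas a cell after a step depends on the state, on
    all scanned symbols and on a neighbouring cell. So every tableau entry carries copies of these
    data; constraints along a row make the copies agree, and a constraint between an entry and its
    successor in time then sees all it needs. Columns move with the heads, hence no head position is
    stored. The price is that the borders are unconstrained and wrong values spread inwards by one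
    column per step; rows are wide enough for the centre column to be right until the last row.

    In the digraph the path of a node has [N.+1] points: one possible entry point per node, and a
    last point that no conflict arc enters. Dropping the single arc into the last point thus
    neutralises a node outside the independent set. Conversely, arcs entering different paths are
    different, so each such node costs at least one arc. Weights are 0 or 1, and the score counts
    the kept arcs.

    A yes-instance is a string that some instance encodes, so the converse direction also needs the
    encoding to determine every value an acyclic digraph can use. *)

Local Notation sym := (option (bool + unit)).
Local Notation mark := (Some (inr tt) : sym).

(* A head position together with the contents of a one-way infinite tape; the
   head never leaves it. *)
Definition atape : Type := nat * (nat -> sym).

Definition ascan (t : atape) : sym := t.2 t.1.
Arguments ascan : simpl never.

Definition awrite (a : sym * move) (t : atape) : atape :=
  (match a.2 with MoveL => t.1.-1 | MoveR => t.1.+1 | Stay => t.1 end,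
   fun j => if j == t.1 then a.1 else t.2 j).

Lemma awrite_scan_stay t : awrite (ascan t, Stay) t = t.
Proof.
case: t => p s; rewrite /awrite /ascan /=; congr pair.
by apply: functional_extensionality => j; case: eqP => [->|].
Qed.

Section Fragments.
Variable K : nat.
Implicit Types (T : 'I_K.+2 -> atape).

Notation scans := {ffun 'I_K.+2 -> sym}.
Notation actions := ('I_K.+2 -> sym * move).

Definition scan T : scans := [ffun i => ascan (T i)].

Definition act (a : actions) T : 'I_K.+2 -> atape := fun i => awrite (a i) (T i).

(** At position 0 [awrite] would truncate a left move, while the two-way tape of the machine would
    really move. *)
Definition safe (a : actions) T := forall i, (a i).2 = MoveL -> 0 < (T i).1.

(** A transition to [None] leaves the fragment but still performs its actions; sequencing therefore
    costs no extra step. *)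
Record fragment := Fragment {
  fstate : finType;
  fentry : fstate;
  fnext : fstate -> scans -> option fstate * actions
}.

Inductive exits (F : fragment) :
  fstate F -> ('I_K.+2 -> atape) -> nat -> ('I_K.+2 -> atape) -> Prop :=
| exits_end q T a : fnext q (scan T) = (None, a) -> safe a T ->
    exits q T 1 (act a T)
| exits_step q q' T a k T' : fnext q (scan T) = (Some q', a) -> safe a T ->
    exits q' (act a T) k T' -> exits q T k.+1 T'.

Definition runs (F : fragment) T k T' := exits (fentry F) T k T'.

Definition stay (sc : scans) : actions := fun i => (sc i, Stay).

Lemma act_stay T : act (stay (scan T)) T = T.
Proof.
apply: functional_extensionality => i.
by rewrite /act /stay ffunE awrite_scan_stay.
Qed.

Definition act_frag (a : scans -> actions) : fragment :=
  @Fragment unit tt (fun _ sc => (None, a sc)).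

Definition seq_frag (F1 F2 : fragment) : fragment :=
  @Fragment (fstate F1 + fstate F2)%type (inl (fentry F1)) (fun q sc =>
    match q with
    | inl q1 => let r := fnext q1 sc in
        (Some (if r.1 is Some q' then inl q' else inr (fentry F2)), r.2)
    | inr q2 => let r := fnext q2 sc in (omap inr r.1, r.2)
    end).

Definition if_frag (b : pred scans) (F1 F2 : fragment) : fragment :=
  @Fragment (option (fstate F1 + fstate F2))%type None (fun q sc =>
    match q with
    | None => (Some (Some (if b sc then inl (fentry F1) else inr (fentry F2))),
               stay sc)
    | Some (inl q1) => let r := fnext q1 sc in (omap (Some \o inl) r.1, r.2)
    | Some (inr q2) => let r := fnext q2 sc in (omap (Some \o inr) r.1, r.2)
    end).

(** The successful test itself performs [a], so testing and decrementing a loop counter is a single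
    step. *)
Definition while_frag (b : pred scans) (a : scans -> actions) (F : fragment) :
    fragment :=
  @Fragment (option (fstate F)) None (fun q sc =>
    match q with
    | None => if b sc then (Some (Some (fentry F)), a sc) else (None, stay sc)
    | Some q => let r := fnext q sc in (Some r.1, r.2)
    end).

Lemma runs_act a T : safe (a (scan T)) T ->
  runs (act_frag a) T 1 (act (a (scan T)) T).
Proof. exact: exits_end. Qed.

Lemma runs_seq F1 F2 T k1 T1 k2 T2 :
  runs F1 T k1 T1 -> runs F2 T1 k2 T2 -> runs (seq_frag F1 F2) T (k1 + k2) T2.
Proof.
rewrite /runs /= => r1 r2.
have {r2} r2 : @exits (seq_frag F1 F2) (inr (fentry F2)) T1 k2 T2.
  elim: r2 => [q U a nx sf|q q' U a k U' nx sf _ IH].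
    by apply: exits_end sf; rewrite /= nx.
  by apply: exits_step sf IH; rewrite /= nx.
elim: r1 r2 => [q U a nx sf|q q' U a k U' nx sf _ IH] r2.
  by apply: exits_step sf r2; rewrite /= nx.
by apply: exits_step sf (IH r2); rewrite /= nx.
Qed.

Lemma runs_if (b : pred scans) F1 F2 T k T' :
  runs (if b (scan T) then F1 else F2) T k T' ->
  runs (if_frag b F1 F2) T k.+1 T'.
Proof.
move=> r; apply: (@exits_step (if_frag b F1 F2) None (Some (if b (scan T)
  then inl (fentry F1) else inr (fentry F2))) _ (stay (scan T))) => //.
rewrite act_stay; case: (b (scan T)) r => r.
  elim: r => [q U a nx sf|q q' U a j U' nx sf _ IH].
    by apply: exits_end sf; rewrite /= nx.
  by apply: exits_step sf IH; rewrite /= nx.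
elim: r => [q U a nx sf|q q' U a j U' nx sf _ IH].
  by apply: exits_end sf; rewrite /= nx.
by apply: exits_step sf IH; rewrite /= nx.
Qed.

Lemma runs_while_stop (b : pred scans) a F T :
  ~~ b (scan T) -> runs (while_frag b a F) T 1 T.
Proof.
move=> nb; rewrite -{2}(act_stay T); apply: exits_end => //=.
by rewrite (negbTE nb).
Qed.

Lemma runs_while_next (b : pred scans) a F T k1 T1 k2 T2 :
  b (scan T) -> safe (a (scan T)) T ->
  runs F (act (a (scan T)) T) k1 T1 -> runs (while_frag b a F) T1 k2 T2 ->
  runs (while_frag b a F) T (k1 + k2).+1 T2.
Proof.
move=> bT sf r1 r2.
apply: (@exits_step (while_frag b a F) None (Some (fentry F)) _ (a (scan T))) => //=.
  by rewrite bT.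
elim: r1 r2 => [q U c nx sf'|q q' U c j U' nx sf' _ IH] r2.
  by apply: exits_step sf' r2; rewrite /= nx.
by apply: exits_step sf' (IH r2); rewrite /= nx.
Qed.

Definition tm_of (F : fragment) : tm :=
  @TM K (option (fstate F)) unit (Some (fentry F)) (pred1 None) pred0
    (fun q sc => if q is Some q' then fnext q' sc else (None, stay sc)).

(** Nothing is said about cells to the left of the origin; the origin may thus be placed anywhere on
    the two-way tape, as long as all moves are [safe]. *)
Definition represents F (t : tape (tm_of F)) (u : atape) :=
  [/\ scanned t = ascan u,
      forall i, nth None (right_of t) i = u.2 (u.1 + i.+1) &
      forall i, i < u.1 -> nth None (left_of t) i = u.2 (u.1 - i.+1)].

Lemma represents_write F (a : sym * move) (t : tape (tm_of F)) (u : atape) :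
  represents t u -> (a.2 = MoveL -> 0 < u.1) ->
  represents (@write_move (tm_of F) a t) (awrite a u).
Proof.
case: t u a => l c r [p s] [b m] [/= Hc Hr Hl] /=; rewrite /ascan /= in Hc.
have upd j : j != p -> (if j == p then b else s j) = s j by move/negbTE=> ->.
case: m => [/(_ erefl) p0| _ | _]; split; rewrite /ascan /=.
- by rewrite upd; [rewrite -nth0 (Hl 0) // subn1|lia].
- case=> [|i] /=; first by rewrite (_ : p.-1 + 1 = p) ?eqxx //; lia.
  by rewrite Hr upd; [congr s|]; lia.
- move=> i ip; rewrite nth_behead Hl; last by lia.
  by rewrite upd; [congr s|]; lia.
- by rewrite upd; [rewrite -nth0 Hr addn1|lia].
- by move=> i; rewrite nth_behead Hr upd; [congr s|]; lia.
- case=> [|i] ip /=; first by rewrite (_ : p.+1 - 1 = p) ?eqxx //; lia.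
  rewrite Hl ?upd; first (by congr s; lia); first by lia.
  by lia.
- by rewrite eqxx.
- by move=> i; rewrite Hr upd //; lia.
- by move=> i ip; rewrite Hl // upd //; lia.
Qed.

Lemma exits_tm F q T k T' (c : {ffun 'I_K.+2 -> tape (tm_of F)}) :
  @exits F q T k T' -> (forall i, represents (c i) (T i)) ->
  exists c' : {ffun 'I_K.+2 -> tape (tm_of F)},
    iter k (@step (tm_of F)) (Some q, c) = (None, c') /\
    (forall i, represents (c' i) (T' i)).
Proof.
have scE U (d : {ffun 'I_K.+2 -> tape (tm_of F)}) :
    (forall i, represents (d i) (U i)) -> [ffun i => scanned (d i)] = scan U.
  by move=> dU; apply/ffunP => i; rewrite !ffunE; case: (dU i).
move=> e; elim: e c => {q T k T'}
  [q U a nx sf|q q' U a j U' nx sf _ IH] c cU.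
  exists [ffun i => @write_move (tm_of F) (a i) (c i)]; split.
    by rewrite /= /step /= (scE U) // nx.
  by move=> i; rewrite ffunE; apply: represents_write => //; apply: sf.
have -> : iter j.+1 (@step (tm_of F)) (Some q, c) = iter j (@step (tm_of F))
    (Some q', [ffun i => @write_move (tm_of F) (a i) (c i)]).
  by rewrite iterSr; congr iter; rewrite /step /= (scE U) // nx.
by apply: IH => i; rewrite ffunE; apply: represents_write => //; apply: sf.
Qed.

End Fragments.

Lemma runs_while_iter K (b : pred {ffun 'I_K.+2 -> sym}) a (F : fragment K)
    (T : nat -> 'I_K.+2 -> atape) n k :
  (forall m, m < n -> [/\ b (scan (T m)), safe (a (scan (T m))) (T m) &
     runs F (act (a (scan (T m))) (T m)) k (T m.+1)]) ->
  ~~ b (scan (T n)) ->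
  runs (while_frag b a F) (T 0) (n * k.+1).+1 (T n).
Proof.
elim: n T => [|n IH] T H nb; first exact: runs_while_stop.
have [b0 s0 r0] := H 0 isT.
have {}IH := IH (fun m => T m.+1) (fun m mn => H m.+1 mn) nb.
have -> : (n.+1 * k.+1).+1 = (k + (n * k.+1).+1).+1 by lia.
exact: runs_while_next b0 s0 r0 IH.
Qed.

(** * A counter language *)

(* Register 0 is the head position on a read-only copy of the input. *)
Inductive core :=
| Skip
| Inc of nat
| Dec of nat
| Emit of bool
| Then of core & core
| IfZ of nat & core & core
| IfBit of core & core
| Loop of nat & core.

Definition upd (s : nat -> nat) r v : nat -> nat :=
  fun r' => if r' == r then v else s r'.

(** The number is the exact step count of the compiled fragment, so that [exec_compile] transfers it
    unchanged. *)
Inductive exec (x : seq bool) :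
  core -> (nat -> nat) -> seq bool -> nat -> (nat -> nat) -> seq bool -> Prop :=
| exec_skip s o : exec x Skip s o 1 s o
| exec_inc r s o : exec x (Inc r) s o 1 (upd s r (s r).+1) o
| exec_dec r s o : exec x (Dec r) s o 1 (upd s r (s r).-1) o
| exec_emit b s o : exec x (Emit b) s o 1 s (rcons o b)
| exec_then c1 c2 s o k1 s1 o1 k2 s2 o2 :
    exec x c1 s o k1 s1 o1 -> exec x c2 s1 o1 k2 s2 o2 ->
    exec x (Then c1 c2) s o (k1 + k2) s2 o2
| exec_ifz r c1 c2 s o k s' o' :
    exec x (if s r == 0 then c1 else c2) s o k s' o' ->
    exec x (IfZ r c1 c2) s o k.+1 s' o'
| exec_ifbit c1 c2 s o k s' o' :
    exec x (if (0 < s 0) && nth false x (s 0).-1 then c1 else c2) s o k s' o' ->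
    exec x (IfBit c1 c2) s o k.+1 s' o'
| exec_loop_stop r c s o : s r = 0 -> exec x (Loop r c) s o 1 s o
| exec_loop_next r c s o k1 s1 o1 k2 s2 o2 : 0 < s r ->
    exec x c (upd s r (s r).-1) o k1 s1 o1 ->
    exec x (Loop r c) s1 o1 k2 s2 o2 ->
    exec x (Loop r c) s o (k1 + k2).+1 s2 o2.

(** One step emits at most one bit. This bounds the time for rewinding the output tape. *)
Lemma exec_size x c s o k s' o' :
  exec x c s o k s' o' -> size o' <= size o + k.
Proof. by elim=> *; rewrite ?size_rcons; lia. Qed.

Fixpoint max_reg c :=
  match c with
  | Skip | Emit _ => 0
  | Inc r | Dec r => r
  | Then c1 c2 | IfBit c1 c2 => maxn (max_reg c1) (max_reg c2)
  | IfZ r c1 c2 => maxn r (maxn (max_reg c1) (max_reg c2))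
  | Loop r c => maxn r (max_reg c)
  end.

(** * Compilation of counter programs into machine fragments *)

Section Compile.
Variable K : nat.

Definition move_at r m (sc : {ffun 'I_K.+2 -> sym}) (i : 'I_K.+2) :=
  (sc i, if i == r.+1 :> nat then m else Stay).

(** Staying put on the mark makes the decrement truncated, like [.-1], and keeps it [safe]. *)
Definition dec_at r (sc : {ffun 'I_K.+2 -> sym}) (i : 'I_K.+2) :=
  (sc i, if (i == r.+1 :> nat) && (sc i != mark) then MoveL else Stay).

Definition emit_at b (sc : {ffun 'I_K.+2 -> sym}) (i : 'I_K.+2) : sym * move :=
  if i == 0 :> nat then (Some (inl b), MoveR) else (sc i, Stay).

Fixpoint compile c : fragment K :=
  match c with
  | Skip => act_frag (@stay K)
  | Inc r => act_frag (move_at r MoveR)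
  | Dec r => act_frag (dec_at r)
  | Emit b => act_frag (emit_at b)
  | Then c1 c2 => seq_frag (compile c1) (compile c2)
  | IfZ r c1 c2 => if_frag (fun sc => sc (inord r.+1) == mark)
                           (compile c1) (compile c2)
  | IfBit c1 c2 => if_frag (fun sc => sc (inord 1) == Some (inl true))
                           (compile c1) (compile c2)
  | Loop r c => while_frag (fun sc => sc (inord r.+1) != mark) (dec_at r)
                           (compile c)
  end.

Variable x : seq bool.

Definition bit_at (o : seq bool) j : sym :=
  if j < size o then Some (inl (nth false o j)) else None.

(* Registers sit on tapes 1, 2, ... as distances to a mark; the output is written
   on tape 0 to the right of the (erased) input. *)
Definition reg_tape r p : atape :=
  (p, fun j => if j is j'.+1 then if r == 0 then bit_at x j' else None else mark).

Definition out_tape o : atape :=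
  ((size x).+1 + size o,
   fun j => if j <= size x then None else bit_at o (j - (size x).+1)).

Definition tapes_of (s : nat -> nat) o (i : 'I_K.+2) : atape :=
  if i is Ordinal r.+1 _ then reg_tape r (s r) else out_tape o.

Lemma scan_reg s o r : r <= K -> scan (tapes_of s o) (inord r.+1) =
  ascan (reg_tape r (s r)).
Proof.
move=> rK; rewrite ffunE /inord /insubd insubT //=.
Qed.

Lemma reg_tape_mark r p : (ascan (reg_tape r p) == mark) = (p == 0).
Proof.
by case: p => //= p; rewrite /ascan /= /bit_at; case: ifP => //; case: ifP.
Qed.

Lemma act_inc s o r :
  act (move_at r MoveR (scan (tapes_of s o))) (tapes_of s o) =
  tapes_of (upd s r (s r).+1) o.
Proof.
apply: functional_extensionality => -[[|j] jK]; rewrite /act /move_at ffunE /=.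
  exact: awrite_scan_stay.
rewrite eqSS /upd; case: eqP => [->|_]; last exact: awrite_scan_stay.
rewrite /awrite /reg_tape /ascan /=; congr pair.
by apply: functional_extensionality => i; case: eqP => // ->.
Qed.

Lemma act_dec s o r :
  act (dec_at r (scan (tapes_of s o))) (tapes_of s o) =
  tapes_of (upd s r (s r).-1) o.
Proof.
apply: functional_extensionality => -[[|j] jK]; rewrite /act /dec_at ffunE /=.
  exact: awrite_scan_stay.
rewrite eqSS /upd; case: eqP => [->|_] /=; last exact: awrite_scan_stay.
rewrite reg_tape_mark; case: eqP => [->|_] /=; first exact: awrite_scan_stay.
rewrite /awrite /reg_tape /ascan /=; congr pair.
by apply: functional_extensionality => i; case: eqP => // ->.
Qed.

Lemma safe_dec s o r : safe (dec_at r (scan (tapes_of s o))) (tapes_of s o).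
Proof.
move=> [[|j] jK]; rewrite /dec_at ffunE //= reg_tape_mark.
by case: (s j) => //=; rewrite andbF.
Qed.

Lemma act_emit s o b :
  act (emit_at b (scan (tapes_of s o))) (tapes_of s o) = tapes_of s (rcons o b).
Proof.
apply: functional_extensionality => -[[|j] jK]; rewrite /act /emit_at /= ?ffunE.
  rewrite /awrite /out_tape /= size_rcons; congr pair; first by lia.
  apply: functional_extensionality => i; rewrite /bit_at size_rcons nth_rcons.
  case: (leqP i (size x)) => ix; first by case: eqP => //; lia.
  case: eqP => [->|ne].
    rewrite (_ : _ - _ = size o); last by lia.
    by rewrite ltnn eqxx leqnn.
  rewrite ltnS; case: ltngtP => //; lia.
exact: awrite_scan_stay.
Qed.

Lemma exec_compile c s o k s' o' : max_reg c <= K -> exec x c s o k s' o' ->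
  runs (compile c) (tapes_of s o) k (tapes_of s' o').
Proof.
move=> + e; elim: e => /=.
- move=> {}s {}o _; rewrite -{2}(act_stay (tapes_of s o)); exact: runs_act.
- move=> r {}s {}o _; rewrite -act_inc; apply: runs_act => -[[|j] jK] //=.
  by rewrite /move_at; case: ifP.
- move=> r {}s {}o _; rewrite -act_dec; exact/runs_act/safe_dec.
- move=> b {}s {}o _; rewrite -act_emit; apply: runs_act => i.
  by rewrite /emit_at; case: ifP.
- move=> c1 c2 {}s {}o k1 s1 o1 k2 s2 o2 _ IH1 _ IH2.
  by rewrite geq_max => /andP[? ?]; apply: runs_seq (IH1 _) (IH2 _).
- move=> r c1 c2 {}s {}o {}k {}s' {}o' _ IH; rewrite !geq_max => /and3P[? ? ?].
  apply: runs_if; rewrite scan_reg // reg_tape_mark; move: IH.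
  by case: ifP => _; apply.
- move=> c1 c2 {}s {}o {}k {}s' {}o' _ IH; rewrite !geq_max => /andP[? ?].
  apply: runs_if; rewrite scan_reg //.
  have -> : (ascan (reg_tape 0 (s 0)) == Some (inl true)) =
            ((0 < s 0) && nth false x (s 0).-1).
    case: (s 0) => //= p; rewrite /ascan /= /bit_at.
    by case: ltnP => px; [case: nth | rewrite nth_default].
  by move: IH; case: ifP => _; apply.
- move=> r c1 {}s {}o s0; rewrite geq_max => /andP[? ?].
  by apply: runs_while_stop; rewrite scan_reg // reg_tape_mark s0.
- move=> r c1 {}s {}o k1 s1 o1 k2 s2 o2 s0 _ IH1 _ IH2.
  rewrite geq_max => /andP[rK cK]; apply: runs_while_next.
  + by rewrite scan_reg // reg_tape_mark -lt0n.
  + exact: safe_dec.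
  + by rewrite act_dec; apply: IH1.
  + by apply: IH2; rewrite geq_max rK.
Qed.

End Compile.

(** * The complete machine: copying the input, running the program, rewinding the output *)

Section Program.
Variables (K : nat) (c : core).

Definition on_tape (n : nat) m (sc : {ffun 'I_K.+2 -> sym}) (i : 'I_K.+2) :=
  (sc i, if i == n :> nat then m else Stay).

Definition put_marks (sc : {ffun 'I_K.+2 -> sym}) (i : 'I_K.+2) : sym * move :=
  match val i with
  | 0 => (sc i, Stay)
  | 1 => (mark, MoveR)
  | _ => (mark, Stay)
  end.

(** Tape 2 advances with the copy, so register 1 ends up holding the input length. Erasing tape 0
    leaves the blank at which the final rewind stops. *)
Definition copy_bit (sc : {ffun 'I_K.+2 -> sym}) (i : 'I_K.+2) : sym * move :=
  match val i with
  | 0 => (None, MoveR)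
  | 1 => (sc ord0, MoveR)
  | 2 => (sc i, MoveR)
  | _ => (sc i, Stay)
  end.

Definition program : fragment K :=
  seq_frag (act_frag put_marks)
  (seq_frag (while_frag (fun sc => sc ord0 != None) copy_bit (act_frag (@stay K)))
  (seq_frag (act_frag (on_tape 1 MoveL))
  (seq_frag (while_frag (fun sc => sc (inord 1) != mark) (on_tape 1 MoveL)
                        (act_frag (@stay K)))
  (seq_frag (compile K c)
  (seq_frag (act_frag (on_tape 0 MoveL))
  (seq_frag (while_frag (fun sc => sc ord0 != None) (on_tape 0 MoveL)
                        (act_frag (@stay K)))
  (act_frag (on_tape 0 MoveR)))))))).

Variable x : seq bool.

(** The input starts at position 1 because the final rewind stops on the blank just left of the
    output; for an empty input this blank is position 0. *)
Definition tapes_init (i : 'I_K.+2) : atape :=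
  if val i is 0 then (1, fun j => if j is j'.+1 then bit_at x j' else None)
  else (0, fun _ => None).

Definition tapes_copy m (i : 'I_K.+2) : atape :=
  match val i with
  | 0 => (m.+1, fun j => if j <= m then None else bit_at x j.-1)
  | 1 => (m.+1, fun j => if j is j'.+1 then
                  (if j' < m then bit_at x j' else None) else mark)
  | 2 => (m, fun j => if j is 0 then mark else None)
  | _ => (0, fun j => if j is 0 then mark else None)
  end.

Definition tapes_read p (i : 'I_K.+2) : atape :=
  match val i with
  | 0 => out_tape x [::]
  | 1 => reg_tape x 0 p
  | 2 => reg_tape x 1 (size x)
  | r.+1 => reg_tape x r 0
  end.

Definition start_regs (r : nat) := if r == 1 then size x else 0.

Lemma tapes_read0 : tapes_read 0 = tapes_of x start_regs [::].
Proof. by apply: functional_extensionality => -[[|[|[|j]]] jK]. Qed.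

Lemma runs_stay T : runs (act_frag (@stay K)) T 1 T.
Proof. by rewrite -{2}(act_stay T); exact: runs_act. Qed.

Lemma act_marks :
  act (put_marks (scan tapes_init)) tapes_init = tapes_copy 0.
Proof.
apply: functional_extensionality => -[[|[|[|j]]] jK];
  rewrite /act /put_marks /tapes_copy ?ffunE //=.
- rewrite awrite_scan_stay /tapes_init /=; congr pair.
  by apply: functional_extensionality => -[].
- by rewrite /awrite /=; congr pair; apply: functional_extensionality => -[].
- by rewrite /awrite /=; congr pair; apply: functional_extensionality => -[].
- by rewrite /awrite /=; congr pair; apply: functional_extensionality => -[].
Qed.

Lemma act_copy m : m < size x ->
  act (copy_bit (scan (tapes_copy m))) (tapes_copy m) = tapes_copy m.+1.
Proof.
move=> mx; apply: functional_extensionality => -[[|[|[|j]]] jK];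
  rewrite /act /copy_bit /= ?ffunE.
- rewrite /awrite /tapes_copy /=; congr pair.
  apply: functional_extensionality => i.
  case: eqP => [->|ne]; first by rewrite leqnn.
  by rewrite (_ : (i <= m.+1) = (i <= m)) //; lia.
- rewrite /awrite /tapes_copy /= /ascan /= ltnn; congr pair.
  apply: functional_extensionality => -[|i] //.
  by rewrite eqSS ltnS; case: ltngtP => [||->].
- rewrite /awrite /tapes_copy /= /ascan /=; congr pair.
  by apply: functional_extensionality => i; case: eqP => // ->.
- exact: awrite_scan_stay.
Qed.

Lemma act_left1 m : act (on_tape 1 MoveL (scan (tapes_read m))) (tapes_read m) =
  tapes_read m.-1.
Proof.
apply: functional_extensionality => -[[|[|[|j]]] jK];
  rewrite /act /on_tape ?ffunE; try exact: awrite_scan_stay.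
rewrite /tapes_read /awrite /reg_tape /= /ascan /=; congr pair.
by apply: functional_extensionality => i; case: eqP => // ->.
Qed.

Lemma tapes_copy_end : tapes_copy (size x) = tapes_read (size x).+1.
Proof.
apply: functional_extensionality => -[[|[|[|j]]] jK] //=;
  rewrite /tapes_copy /tapes_read /= /out_tape /reg_tape /=.
- rewrite addn0; congr pair; apply: functional_extensionality => i.
  by case: leqP => // ix; rewrite /bit_at ltn0 ifN //; lia.
- congr pair; apply: functional_extensionality => -[|i] //.
  by rewrite /bit_at /=; case: (ltnP i (size x)).
Qed.

Lemma runs_program k s' o :
  max_reg c <= K ->
  exec x c start_regs [::] k s' o ->
  exists2 T', runs program tapes_init
    (7 + size x * 4 + k + size o * 2) T' & T' ord0 =
  ((size x).+1, (out_tape x o).2).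
Proof.
move=> cK e.
pose T0 := tapes_of x s' o : 'I_K.+2 -> atape.
pose T p (i : 'I_K.+2) := if val i is 0 then (p, (out_tape x o).2) else T0 i.
have actT p m : act (on_tape 0 m (scan (T p))) (T p) =
    T (match m with MoveL => p.-1 | MoveR => p.+1 | Stay => p end).
  apply: functional_extensionality => -[[|j] jK]; rewrite /act /on_tape ?ffunE;
    last exact: awrite_scan_stay.
  rewrite /T /awrite /= /ascan /=; congr pair.
  by apply: functional_extensionality => i; case: eqP => // ->.
have TT : T ((size x).+1 + size o) = T0.
  by apply: functional_extensionality => -[[|j] jK].
exists (T (size x).+1) => //.
have -> : 7 + size x * 4 + k + size o * 2 =
  1 + ((size x * 2).+1 + (1 + ((size x * 2).+1 + (k + (1 +
  ((size o * 2).+1 + 1)))))) by lia.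
apply: runs_seq; first by apply: runs_act => -[[|[|j]] jK].
rewrite act_marks; apply: runs_seq.
  apply: (@runs_while_iter _ _ _ _ tapes_copy (size x) 1) => [m mx|].
    rewrite ffunE /tapes_copy /= /ascan /= ltnn /bit_at mx; split=> //.
      by move=> [[|[|[|j]]] jK].
    by rewrite act_copy //; exact: runs_stay.
  by rewrite ffunE /tapes_copy /= /ascan /= ltnn /bit_at ltnn.
rewrite tapes_copy_end; apply: runs_seq.
  by apply: runs_act => -[[|[|j]] jK].
rewrite act_left1 /=; apply: runs_seq.
  have := (@runs_while_iter K (fun sc => sc (inord 1) != mark) (on_tape 1 MoveL)
    (act_frag (@stay K)) (fun m => tapes_read (size x - m)) (size x) 1).
  rewrite subn0 subnn tapes_read0; apply=> [m mx|].
    split.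
    - by rewrite ffunE /tapes_read /= inordK // reg_tape_mark; lia.
    - by move=> [[|[|j]] jK] //= _; lia.
    - by rewrite act_left1 -subnS; exact: runs_stay.
  by rewrite -tapes_read0 ffunE /tapes_read /= inordK // reg_tape_mark.
apply: runs_seq; first exact: exec_compile e.
rewrite -/T0 -TT; apply: runs_seq.
  by apply: runs_act => -[[|j] jK].
rewrite actT addSn /=; apply: runs_seq.
  have := (@runs_while_iter K (fun sc => sc ord0 != None) (on_tape 0 MoveL)
    (act_frag (@stay K)) (fun m => T (size x + size o - m)) (size o) 1).
  rewrite subn0 addnK; apply=> [m mx|].
    split.
    - rewrite ffunE /T /= /ascan /= leqNgt.
      have -> /= : size x < size x + size o - m by lia.
      by rewrite /bit_at ifT //; lia.
    - by move=> [[|j] jK] //= _; rewrite /T /=; lia.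
    - by rewrite actT -subnS; exact: runs_stay.
  by rewrite ffunE /T /= /ascan /= leqnn.
have -> : T (size x).+1 = act (on_tape 0 MoveR (scan (T (size x)))) (T (size x)).
  by rewrite actT.
by apply: runs_act => -[[|j] jK].
Qed.

End Program.

Lemma iter_step_halted (M : tm) (d : config M) n :
  halting d.1 -> iter n (@step M) d = d.
Proof. by move=> h; elim: n => //= n ->; rewrite /step h. Qed.

(** [polytime_fun] inspects the configuration at exactly the polynomial time, while the machines
    only obey it as an upper bound. *)
Lemma run_halted (M : tm) inputs k k' : halting (run M inputs k).1 -> k <= k' ->
  run M inputs k' = run M inputs k.
Proof.
move=> h kk'; rewrite /run -(subnK kk') iterD.
exact: iter_step_halted.
Qed.

Lemma core_polytime (f : seq bool -> seq bool) c e :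
  (forall x, exists k s', exec x c (start_regs x) [::] k s' (f x) /\
    k <= (size x + 2) ^ e) ->
  polytime_fun f.
Proof.
move=> H; pose K := (max_reg c).
(* The factor 3 covers the [k] steps of the program and twice the output length, itself at most [k],
   for rewinding. *)
pose P : {poly nat} := (7%:P + 'X * 4%:P + ('X + 2%:P) ^+ e * 3%:P)%R.
have PE n : (P.[n])%R = 7 + n * 4 + (n + 2) ^ e * 3.
  by rewrite /P !(hornerD, hornerM, hornerC, hornerX, horner_exp) natrXE.
exists (tm_of (program K c)), P => x.
have [k [s' [ex kb]]] := H x.
have [T' r T'0] := runs_program (leqnn _) ex.
pose c0 := init (tm_of (program K c)) [:: x].
have c0E i : @represents K (program K c) (c0.2 i) (tapes_init x i).
  rewrite /c0 /= ffunE /input_tape; case: i => -[|j] jK /=.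
    split.
    - by rewrite /tapes_init /ascan /=; case: (x).
    - move=> i /=; rewrite nth_behead; case: (ltnP i.+1 (size x)) => ix.
        by rewrite (nth_map false) // /bit_at ix.
      by rewrite nth_default ?size_map // /bit_at ltnNge ix.
    - by move=> [].
  by rewrite nth_nil; split=> //= i; rewrite ?nth_nil.
have [c' [c'E c'T]] := exits_tm r c0E.
have bound : 7 + size x * 4 + k + size (f x) * 2 <= P.[size x]%R.
  by have := exec_size ex; rewrite PE /=; lia.
have -> : run (tm_of (program K c)) [:: x] P.[size x]%R = (None, c').
  rewrite (run_halted _ bound) /run -/c0 [c0]surjective_pairing c'E //.
split=> //; rewrite /output; case: (c'T ord0); rewrite T'0 => h0 h1 _.
(* The cells behind the output are blank, so the leading bits end exactly where the output does. *)
have lead : forall (l : seq (cell (tm_of (program K c)))) (o : seq bool),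
    (forall i, nth None l i = bit_at o i) -> leading_bits l = o.
  elim=> [|a l IH] [|b o] //= h.
  - by have := h 0.
  - by have := h 0; rewrite /= => ->.
  - have /= -> := h 0; congr cons; apply: IH => i.
    by have := h i.+1; rewrite /bit_at /= ltnS.
apply: lead => -[|i] /=.
  by rewrite h0 /ascan /= ltnn subnn.
rewrite h1 /= ifN; last by lia.
by congr bit_at; lia.
Qed.

(** * Bounded execution of the counter language *)

Definition execb x c s o b s' o' := exists2 k, k <= b & exec x c s o k s' o'.

Section ExecBounded.
Variable x : seq bool.

Lemma execb_to c s o b s1 o1 b' s' o' : execb x c s o b s1 o1 ->
  s1 = s' -> o1 = o' -> b <= b' -> execb x c s o b' s' o'.
Proof. by move=> [k kb e] <- <- bb'; exists k => //; apply: leq_trans bb'. Qed.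

Lemma execb_skip s o : execb x Skip s o 1 s o.
Proof. by exists 1 => //; constructor. Qed.

Lemma execb_inc r s o : execb x (Inc r) s o 1 (upd s r (s r).+1) o.
Proof. by exists 1 => //; constructor. Qed.

Lemma execb_dec r s o : execb x (Dec r) s o 1 (upd s r (s r).-1) o.
Proof. by exists 1 => //; constructor. Qed.

Lemma execb_emit b s o : execb x (Emit b) s o 1 s (rcons o b).
Proof. by exists 1 => //; constructor. Qed.

Lemma execb_then c1 c2 s o b1 s1 o1 b2 s2 o2 :
  execb x c1 s o b1 s1 o1 -> execb x c2 s1 o1 b2 s2 o2 ->
  execb x (Then c1 c2) s o (b1 + b2) s2 o2.
Proof.
move=> [k1 kb1 e1] [k2 kb2 e2]; exists (k1 + k2); first exact: leq_add.
exact: exec_then e1 e2.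
Qed.

Lemma execb_ifz r c1 c2 s o b s' o' :
  execb x (if s r == 0 then c1 else c2) s o b s' o' ->
  execb x (IfZ r c1 c2) s o b.+1 s' o'.
Proof. by move=> [k kb e]; exists k.+1 => //; apply: exec_ifz. Qed.

Lemma execb_ifbit c1 c2 s o b s' o' :
  execb x (if (0 < s 0) && nth false x (s 0).-1 then c1 else c2) s o b s' o' ->
  execb x (IfBit c1 c2) s o b.+1 s' o'.
Proof. by move=> [k kb e]; exists k.+1 => //; apply: exec_ifbit. Qed.

Lemma execb_loop_stop r c s o : s r = 0 -> execb x (Loop r c) s o 1 s o.
Proof. by exists 1 => //; constructor. Qed.

Lemma execb_loop_next r c s o b1 s1 o1 b2 s2 o2 : 0 < s r ->
  execb x c (upd s r (s r).-1) o b1 s1 o1 ->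
  execb x (Loop r c) s1 o1 b2 s2 o2 ->
  execb x (Loop r c) s o (b1 + b2).+1 s2 o2.
Proof.
move=> r0 [k1 kb1 e1] [k2 kb2 e2]; exists (k1 + k2).+1; first by lia.
exact: exec_loop_next e1 e2.
Qed.

(** [S m] and [O m] are the registers and the output after [m] rounds; the body starts from [S m]
    with the loop register already decremented. *)
Lemma execb_loop (S : nat -> nat -> nat) (O : nat -> seq bool) n b r c s o s' o' b' :
  (forall m, m <= n -> S m r = n - m) ->
  (forall m, m < n -> execb x c (upd (S m) r (n - m.+1)) (O m) b (S m.+1) (O m.+1)) ->
  S 0 = s -> S n = s' -> O 0 = o -> O n = o' -> (n * b.+1).+1 <= b' ->
  execb x (Loop r c) s o b' s' o'.
Proof.
move=> HS Hc <- <- <- <- bb'.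
suff h : execb x (Loop r c) (S 0) (O 0) (n * b.+1).+1 (S n) (O n).
  exact: execb_to h erefl erefl bb'.
elim: n S O HS Hc {bb'} => [|n IH] S O HS Hc.
  by apply: execb_loop_stop; rewrite HS.
have -> : (n.+1 * b.+1).+1 = (b + (n * b.+1).+1).+1 by lia.
apply: (@execb_loop_next _ _ _ _ _ (S 1) (O 1)); first by rewrite HS.
  by have := Hc 0 isT; rewrite HS // subn0 subn1.
apply: (IH (fun m => S m.+1) (fun m => O m.+1)) => m mn; first by rewrite HS.
exact: Hc.
Qed.

End ExecBounded.

(** Register 0 is the input head, odd registers hold variables, and the other even ones form a stack
    of temporaries with level [d]. Variable 0 is register 1, which the machine initialises to the
    input length. *)
Definition rv v := 2 * v + 1.
Definition rt d := 2 * d + 2.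

Ltac dec_regs := repeat match goal with
  | |- context [@eq_op _ ?a ?b] => first
    [ rewrite (_ : (a == b) = true); [| rewrite /rt /rv; lia]
    | rewrite (_ : (a == b) = false); [| rewrite /rt /rv; lia] ]
  end.

Ltac reg_cases := dec_regs;
  match goal with
  | |- context [@eq_op _ ?j ?b] => is_var j;
      let H := fresh in case: (@eqP _ j b) => H; [rewrite ?H|]; reg_cases
  | _ => idtac
  end.

Ltac reg_eq :=
  let j := fresh in apply: functional_extensionality => j; rewrite /upd; reg_cases.

Ltac reg_val := rewrite /upd; dec_regs.

(** * Moving, subtracting, clearing and copying registers *)

Section Macros.
Variable x : seq bool.

Lemma execb_move a b s o : a <> b ->
  execb x (Loop a (Inc b)) s o (s a * 2).+1 (upd (upd s a 0) b (s b + s a)) o.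
Proof.
move=> ab; pose S m := upd (upd s a (s a - m)) b (s b + m).
apply: (@execb_loop x S (fun=> o) (s a) 1) => //.
- by move=> m _; rewrite /S; reg_val.
- move=> m mn; apply: execb_to (execb_inc _ _ _ _) _ _ _ => //.
  by rewrite /S; reg_eq; lia.
- by rewrite /S; reg_eq; lia.
- by rewrite /S; reg_eq; lia.
Qed.

Lemma execb_sub a b s o : a <> b ->
  execb x (Loop a (Dec b)) s o (s a * 2).+1 (upd (upd s a 0) b (s b - s a)) o.
Proof.
move=> ab; pose S m := upd (upd s a (s a - m)) b (s b - m).
apply: (@execb_loop x S (fun=> o) (s a) 1) => //.
- by move=> m _; rewrite /S; reg_val.
- move=> m mn; apply: execb_to (execb_dec _ _ _ _) _ _ _ => //.
  by rewrite /S; reg_eq; lia.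
- by rewrite /S; reg_eq; lia.
- by rewrite /S; reg_eq; lia.
Qed.

Lemma execb_clear a s o :
  execb x (Loop a Skip) s o (s a * 2).+1 (upd s a 0) o.
Proof.
pose S m := upd s a (s a - m).
apply: (@execb_loop x S (fun=> o) (s a) 1) => //.
- by move=> m _; rewrite /S; reg_val.
- move=> m mn; apply: execb_to (execb_skip _ _ _) _ _ _ => //.
  by rewrite /S; reg_eq; lia.
- by rewrite /S; reg_eq; lia.
- by rewrite /S; reg_eq; lia.
Qed.

Lemma execb_move2 a b c s o : a <> b -> a <> c -> b <> c ->
  execb x (Loop a (Then (Inc b) (Inc c))) s o (s a * 3).+1
    (upd (upd (upd s a 0) b (s b + s a)) c (s c + s a)) o.
Proof.
move=> ab ac bc.
pose S m := upd (upd (upd s a (s a - m)) b (s b + m)) c (s c + m).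
apply: (@execb_loop x S (fun=> o) (s a) 2) => //.
- by move=> m _; rewrite /S; reg_val.
- move=> m mn; apply: execb_to (execb_then (execb_inc _ _ _ _)
    (execb_inc _ _ _ _)) _ _ _ => //.
  by rewrite /S; reg_eq; lia.
- by rewrite /S; reg_eq; lia.
- by rewrite /S; reg_eq; lia.
Qed.

End Macros.

(** * Polynomially bounded expressions *)

Inductive expr :=
| EConst of nat
| EVar of nat
| EBit of expr
| EAdd of expr & expr
| ESub of expr & expr
| EMul of expr & expr
| ESum of nat & expr & expr.

Fixpoint eval (x : seq bool) (env : nat -> nat) e : nat :=
  match e with
  | EConst n => n
  | EVar v => env v
  | EBit e => nth false x (eval x env e)
  | EAdd e1 e2 => eval x env e1 + eval x env e2
  | ESub e1 e2 => eval x env e1 - eval x env e2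
  | EMul e1 e2 => eval x env e1 * eval x env e2
  | ESum v e1 e2 => \sum_(i < eval x env e1) eval x (upd env v i) e2
  end.

(* The loop variable is saved in a temporary register, so shadowing is harmless. *)
Definition for_loop v d body :=
  Then (Loop (rv v) (Inc (rt d.+2)))
  (Then (Loop (rt d.+1) (Then body (Inc (rv v))))
  (Then (Loop (rv v) Skip) (Loop (rt d.+2) (Inc (rv v))))).

(** The value is left in [rt d]; the temporaries from level [d] on are zero before, and those above
    [d] again afterwards, so subexpressions can use higher levels. [EBit] moves the input head there
    and back; the extra [Inc 0] skips the mark at position 0. *)
Fixpoint comp_expr e d : core :=
  match e with
  | EConst n => iter n (Then (Inc (rt d))) Skip
  | EVar v => Then (Loop (rv v) (Then (Inc (rt d)) (Inc (rt d.+1))))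
                  (Loop (rt d.+1) (Inc (rv v)))
  | EBit e =>
      Then (comp_expr e d.+1)
      (Then (Loop (rt d.+1) (Then (Inc 0) (Inc (rt d.+2))))
      (Then (Inc 0)
      (Then (IfBit (Inc (rt d)) Skip)
      (Then (Dec 0) (Loop (rt d.+2) (Dec 0))))))
  | EAdd e1 e2 =>
      Then (comp_expr e1 d) (Then (comp_expr e2 d.+1) (Loop (rt d.+1) (Inc (rt d))))
  | ESub e1 e2 =>
      Then (comp_expr e1 d) (Then (comp_expr e2 d.+1) (Loop (rt d.+1) (Dec (rt d))))
  | EMul e1 e2 =>
      Then (comp_expr e1 d.+1)
      (Loop (rt d.+1) (Then (comp_expr e2 d.+2) (Loop (rt d.+2) (Inc (rt d)))))
  | ESum v e1 e2 =>
      Then (comp_expr e1 d.+1)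
      (for_loop v d (Then (comp_expr e2 d.+3) (Loop (rt d.+3) (Inc (rt d)))))
  end.

Definition vars (s : nat -> nat) v := s (rv v).

Definition clean d (s : nat -> nat) :=
  s 0 = 0 /\ forall i, d <= i -> s (rt i) = 0.

Definition bounded (x : seq bool) B (s : nat -> nat) :=
  [/\ 2 <= B, size x <= B & forall v, s (rv v) <= B].

Lemma pow_gt0 B k : 2 <= B -> 0 < B ^ k.
Proof. by move=> B2; rewrite expn_gt0; apply/orP; left; lia. Qed.

Lemma leq_pow B i j : 2 <= B -> i <= j -> B ^ i <= B ^ j.
Proof. by move=> B2 ij; apply: leq_pexp2l => //; lia. Qed.

(** As [B] is at least 2, constant factors are absorbed by raising the exponent, which keeps all
    bounds in the form [B ^ k]. *)
Lemma pow_shift B k j : 2 <= B -> 2 ^ j * B ^ k <= B ^ (k + j).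
Proof.
move=> B2; rewrite expnD mulnC leq_mul2l.
by case: j => [|j]; rewrite ?expn0 ?leq_exp2r ?B2 ?orbT.
Qed.

Lemma vars_upd_rv s v n : vars (upd s (rv v) n) = upd (vars s) v n.
Proof.
apply: functional_extensionality => u; rewrite /vars /upd.
by rewrite (_ : (rv u == rv v) = (u == v)) //; rewrite /rv; lia.
Qed.

Lemma vars_upd_rt s d n : vars (upd s (rt d) n) = vars s.
Proof.
by apply: functional_extensionality => u; rewrite /vars; reg_val.
Qed.

Lemma clean_upd_rt d s i n : clean d s -> i < d -> clean d (upd s (rt i) n).
Proof.
move=> [s0 st] id; split; first by reg_val.
by move=> j dj; reg_val; exact: st.
Qed.

Lemma clean_upd_rv d s v n : clean d s -> clean d (upd s (rv v) n).
Proof.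
move=> [s0 st]; split; first by reg_val.
by move=> j dj; reg_val; exact: st.
Qed.

Lemma clean_le d d' s : clean d s -> d <= d' -> clean d' s.
Proof. by move=> [s0 st] dd'; split=> // i di; apply: st; lia. Qed.

Lemma bounded_upd_rt x B s d n : bounded x B s -> bounded x B (upd s (rt d) n).
Proof. by move=> [? ? h]; split=> // v; reg_val. Qed.

Lemma bounded_upd_rv x B s v n : bounded x B s -> n <= B ->
  bounded x B (upd s (rv v) n).
Proof.
move=> [? ? h] nB; split=> // u; rewrite /upd; case: ifP => // _; exact: h.
Qed.

Lemma bounded_le x B B' s : bounded x B s -> B <= B' -> bounded x B' s.
Proof. by move=> [? ? h] ?; split=> [||v]; [lia|lia|have := h v; lia]. Qed.

(** The exponent depends on the expression alone. It bounds value and running time together, since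
    an enclosing loop repeats its body as often as the value says. *)
Definition comp_ok e k := forall x B s d o, bounded x B s -> clean d s ->
  eval x (vars s) e <= B ^ k /\
  execb x (comp_expr e d) s o (B ^ k) (upd s (rt d) (eval x (vars s) e)) o.

Ltac reg_fin Z := rewrite ?addn0 ?add0n ?Z //; try lia.

Lemma comp_const n : comp_ok (EConst n) n.+1.
Proof.
move=> x B s d o [B2 _ _] [_ st]; rewrite [eval _ _ _]/=.
have nB : n < B ^ n.+1.
  apply: (@leq_trans (2 ^ n.+1)); last by rewrite leq_exp2r.
  by have := @ltn_expl 2 n.+1 isT; lia.
split; first by lia.
suff h : execb x (iter n (Then (Inc (rt d))) Skip) s o n.+1
    (upd s (rt d) (s (rt d) + n)) o.
  by apply: execb_to h _ _ nB => //; rewrite st.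
elim: n s {st nB} => [|n IH] s /=.
  by apply: execb_to (execb_skip _ _ _) _ _ _ => //; reg_eq; lia.
apply: execb_to (execb_then (execb_inc _ _ _ _) (IH _)) _ _ _ => //.
by reg_eq; lia.
Qed.

Lemma comp_var v : comp_ok (EVar v) 4.
Proof.
move=> x B s d o [B2 _ hB] [_ st]; rewrite [eval _ _ _]/= /vars.
have b4 := @pow_shift B 1 3 B2; rewrite expn1 in b4.
have vB := hB v.
split; first by apply: leq_trans vB _; move: b4; rewrite addSn add0n; lia.
apply: execb_to (execb_then (execb_move2 _ _ _ _ _ _) (execb_move _ _ _ _)) _ _ _ => //;
  try by rewrite /rv /rt; lia.
- by reg_eq; reg_fin st.
- by reg_val; rewrite st // (_ : 1 + 3 = 4) // in b4 *; lia.
Qed.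

Lemma execb_read x r s o : 0 < s 0 ->
  execb x (IfBit (Inc r) Skip) s o 2 (upd s r (s r + nth false x (s 0).-1)) o.
Proof.
move=> s0; apply: execb_ifbit; rewrite s0 /=; case: nth.
  by rewrite addn1; exact: execb_inc.
by apply: execb_to (execb_skip _ _ _) _ _ _ => //; reg_eq; lia.
Qed.

Lemma comp_bit e k : comp_ok e k -> comp_ok (EBit e) (k + 4).
Proof.
move=> IH x B s d o bs cs.
have [B2 _ _] := bs; have [s0 st] := cs.
have [v1 e1] := IH x B s d.+1 o bs (clean_le cs (leqnSn _)).
rewrite [eval _ _ (EBit e)]/=; set n := eval _ _ _ in v1 e1 *.
have b4 := @pow_shift B k 4 B2; have b0 := @pow_gt0 B k B2.
split; first by case: nth; lia.
apply: execb_to (execb_then e1 (execb_then (execb_move2 _ _ _ _ _ _)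
  (execb_then (execb_inc _ _ _ _) (execb_then (execb_read _ _ _ _)
  (execb_then (execb_dec _ _ _ _) (execb_sub _ _ _ _)))))) _ _ _ => //;
  try by rewrite /rt; lia.
- by reg_eq; rewrite ?s0 ?st; reg_fin st.
- by reg_val; rewrite ?s0 ?st //; lia.
Qed.

Lemma comp_add e1 e2 k1 k2 : comp_ok e1 k1 -> comp_ok e2 k2 ->
  comp_ok (EAdd e1 e2) (k1 + k2 + 3).
Proof.
move=> IH1 IH2 x B s d o bs cs.
have [B2 _ _] := bs; have [s0 st] := cs.
have [v1 x1] := IH1 x B s d o bs cs.
set n1 := eval _ _ _ in v1 x1.
have [] := IH2 x B (upd s (rt d) n1) d.+1 o (bounded_upd_rt _ _ bs).
  by apply: clean_upd_rt => //; apply: clean_le cs _.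
rewrite vars_upd_rt [eval _ _ (EAdd _ _)]/= -/n1.
set n2 := eval _ _ _ => v2 x2.
have b3 := @pow_shift B (k1 + k2) 3 B2.
have b1 := @leq_pow B _ _ B2 (leq_addr k2 k1).
have b2 := @leq_pow B _ _ B2 (leq_addl k1 k2).
have b0 := @pow_gt0 B (k1 + k2) B2.
split; first by lia.
apply: execb_to (execb_then x1 (execb_then x2 (execb_move _ _ _ _))) _ _ _ => //;
  try by rewrite /rt; lia.
- by reg_eq; reg_fin st.
- by reg_val; lia.
Qed.

Lemma comp_sub e1 e2 k1 k2 : comp_ok e1 k1 -> comp_ok e2 k2 ->
  comp_ok (ESub e1 e2) (k1 + k2 + 3).
Proof.
move=> IH1 IH2 x B s d o bs cs.
have [B2 _ _] := bs; have [s0 st] := cs.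
have [v1 x1] := IH1 x B s d o bs cs.
set n1 := eval _ _ _ in v1 x1.
have [] := IH2 x B (upd s (rt d) n1) d.+1 o (bounded_upd_rt _ _ bs).
  by apply: clean_upd_rt => //; apply: clean_le cs _.
rewrite vars_upd_rt [eval _ _ (ESub _ _)]/= -/n1.
set n2 := eval _ _ _ => v2 x2.
have b3 := @pow_shift B (k1 + k2) 3 B2.
have b1 := @leq_pow B _ _ B2 (leq_addr k2 k1).
have b2 := @leq_pow B _ _ B2 (leq_addl k1 k2).
have b0 := @pow_gt0 B (k1 + k2) B2.
split; first by lia.
apply: execb_to (execb_then x1 (execb_then x2 (execb_sub _ _ _ _))) _ _ _ => //;
  try by rewrite /rt; lia.
- by reg_eq; reg_fin st.
- by reg_val; lia.
Qed.

Lemma comp_mul e1 e2 k1 k2 : comp_ok e1 k1 -> comp_ok e2 k2 ->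
  comp_ok (EMul e1 e2) (k1 + k2 + (k1 + k2) + 3).
Proof.
move=> IH1 IH2 x B s d o bs cs.
have [B2 _ _] := bs; have [s0 st] := cs.
have [v1 x1] := IH1 x B s d.+1 o bs (clean_le cs (leqnSn _)).
rewrite [eval _ _ (EMul _ _)]/=.
set n1 := eval _ _ _ in v1 x1 *; set n2 := eval _ _ e2.
pose S m := upd (upd s (rt d.+1) (n1 - m)) (rt d) (m * n2).
have H2 m : n2 <= B ^ k2 /\
  execb x (comp_expr e2 d.+2) (upd (S m) (rt d.+1) (n1 - m.+1)) o
    (B ^ k2) (upd (upd (S m) (rt d.+1) (n1 - m.+1)) (rt d.+2) n2) o.
  have [] := IH2 x B (upd (S m) (rt d.+1) (n1 - m.+1)) d.+2 o.
  - by do !apply: bounded_upd_rt.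
  - by do 3 (apply: clean_upd_rt => //); apply: clean_le cs _; lia.
  by rewrite /S !vars_upd_rt -/n2.
have [v2 _] := H2 0.
have b3 := @pow_shift B (k1 + k2 + (k1 + k2)) 3 B2; rewrite expnD in b3.
have b1 := @leq_pow B _ _ B2 (leq_addr k2 k1).
have b2 := @leq_pow B _ _ B2 (leq_addl k1 k2).
have b0 := @pow_gt0 B (k1 + k2) B2.
set M := B ^ (k1 + k2) in b0 b1 b2 b3.
have n1M : n1 <= M by lia.
have n2M : n2 <= M by lia.
split; first by apply: leq_trans b3; nia.
apply: execb_to (execb_then x1 (@execb_loop x S (fun=> o) n1
  (B ^ k2 + (n2 * 2).+1) _ _ _ _ _ _ (n1 * (B ^ k2 + (n2 * 2).+1).+1).+1
  _ _ _ erefl _ _ _)) _ _ _ => //.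
- by move=> m _; rewrite /S; reg_val.
- move=> m mn; have [_ y] := H2 m.
  apply: execb_to (execb_then y (execb_move _ _ _ _)) _ _ _ => //.
  + by rewrite /rt; lia.
  + by rewrite /S; reg_eq; rewrite ?st //; lia.
  + by reg_val; lia.
- by rewrite /S; reg_eq; rewrite ?st //; lia.
- by rewrite /S; reg_eq; rewrite ?st //; lia.
- by apply: leq_trans b3; nia.
Qed.

(** Serves sums, which accumulate in [rt d] through [acc] and emit nothing, as well as [For]
    commands, which emit through [O] and keep [acc] at 0. *)
Lemma execb_for x v d body s n (acc : nat -> nat) (O : nat -> seq bool) b B :
  clean d s -> s (rv v) <= B -> acc 0 = 0 ->
  (forall m, m < n ->
    let s' a := upd (upd (upd (upd s (rt d.+1) (n - m.+1)) (rt d.+2) (s (rv v)))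
                    (rv v) m) (rt d) a in
    execb x body (s' (acc m)) (O m) b (s' (acc m.+1)) (O m.+1)) ->
  execb x (for_loop v d body) (upd s (rt d.+1) n) (O 0)
    (B * 4 + n * (b + 4) + 4) (upd s (rt d) (acc n)) (O n).
Proof.
move=> [s0 st] vB acc0 H.
pose S m := upd (upd (upd (upd s (rt d.+1) (n - m)) (rt d.+2) (s (rv v)))
                    (rv v) m) (rt d) (acc m).
apply: execb_to (execb_then (execb_move _ _ _ _)
  (execb_then (@execb_loop x S O n b.+1 _ _ _ _ _ _ (n * (b.+2)).+1
                 _ _ _ erefl _ _ _)
  (execb_then (execb_clear _ _ _ _) (execb_move _ _ _ _)))) _ _ _ => //;
  try by rewrite /rv /rt; lia.
- by move=> m _; rewrite /S; reg_val.
- move=> m mn; have := H m mn; set s' := fun _ => _ => /= Hm.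
  rewrite (_ : upd (S m) _ _ = s' (acc m)); last by rewrite /S /s'; reg_eq.
  apply: execb_to (execb_then Hm (execb_inc _ _ _ _)) _ _ _ => //; last by lia.
  by rewrite /S /s'; reg_eq.
- by rewrite /S; reg_eq; rewrite ?st ?acc0 //; lia.
- by rewrite /S; reg_eq; rewrite ?st //; lia.
- by rewrite /S; reg_val; nia.
Qed.

Lemma comp_sum v e1 e2 k1 k2 : comp_ok e1 k1 -> comp_ok e2 k2 ->
  exists k, comp_ok (ESum v e1 e2) k.
Proof.
move=> IH1 IH2; pose k := k1 + 1 + (k1 + 1) * k2.
exists (k + k + 5) => x B s d o bs cs.
have [B2 _ /(_ v) vB] := bs; have [s0 st] := cs.
have [v1 x1] := IH1 x B s d.+1 o bs (clean_le cs (leqnSn _)).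
rewrite [eval _ _ (ESum _ _ _)]/=.
set n1 := eval _ _ _ in v1 x1 *.
pose acc m := \sum_(i < m) eval x (upd (vars s) v i) e2.
rewrite -/(acc n1).
(* The loop variable may grow up to [B ^ k1], so the body runs under the larger bound [B'], and the
   exponents multiply. The [+ 1] ensures [B <= B'] even for [k1 = 0]. *)
pose B' := B ^ (k1 + 1); pose C := B' ^ k2.
have BB : B <= B'.
  by rewrite -{1}(expn1 B) /B'; apply: leq_pow => //; lia.
have B'2 : 2 <= B' by lia.
have n1B : n1 <= B' by apply: leq_trans v1 _; apply: leq_pow; lia.
have H2 s' m o' : bounded x B' s' -> clean d.+3 s' ->
    vars s' = upd (vars s) v m ->
    eval x (upd (vars s) v m) e2 <= C /\
    execb x (comp_expr e2 d.+3) s' o' C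
      (upd s' (rt d.+3) (eval x (upd (vars s) v m) e2)) o'.
  by move=> bs' cs' <-; apply: IH2.
pose s' m a := upd (upd (upd (upd s (rt d.+1) (n1 - m.+1)) (rt d.+2) (s (rv v)))
                    (rv v) m) (rt d) a.
have bs' m a : m <= n1 -> bounded x B' (s' m a).
  move=> mn; apply: bounded_upd_rt; apply: bounded_upd_rv; last by lia.
  by do 2 apply: bounded_upd_rt; apply: bounded_le bs _.
have cs' m a : clean d.+3 (s' m a).
  apply: clean_upd_rt; last by lia.
  apply: clean_upd_rv; do 2 (apply: clean_upd_rt; last by lia).
  by apply: clean_le cs _; lia.
have vs' m a : vars (s' m a) = upd (vars s) v m.
  by rewrite /s' vars_upd_rt vars_upd_rv !vars_upd_rt.
have v2 m : m < n1 -> eval x (upd (vars s) v m) e2 <= C.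
  by move=> mn; apply: (H2 _ m o (bs' m 0 (ltnW mn)) _ (vs' _ _)).1.
have accS m : acc m.+1 = acc m + eval x (upd (vars s) v m) e2.
  by rewrite /acc big_ord_recr.
have accC m : m <= n1 -> acc m <= m * C.
  elim: m => [|m IHm] mn; first by rewrite /acc big_ord0.
  by rewrite accS mulSn addnC; apply: leq_add; [apply: v2|apply: IHm; lia].
have C0 : 0 < C by apply: pow_gt0.
pose M := B' * C; have ME : M = B ^ k by rewrite /M /C /B' -expnM -expnD.
have b5 := @pow_shift B (k + k) 5 B2; rewrite expnD -ME in b5.
have CM : C <= M by rewrite leq_pmull //; lia.
have BM : B' <= M by rewrite leq_pmulr.
have bk : B ^ k1 <= B' by apply: leq_pow; lia.
split; first by have := accC n1 (leqnn _); nia.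
apply: execb_to (execb_then x1 (@execb_for x v d _ s n1 acc (fun=> o)
  (C + (C * 2).+1) B cs vB _ _)) _ _ _ => //.
- by rewrite /acc big_ord0.
- move=> m mn; rewrite -/(s' m _) /=.
  have [_ y] := H2 _ m o (bs' m (acc m) (ltnW mn)) (cs' _ _) (vs' _ _).
  have vm := v2 m mn.
  apply: execb_to (execb_then y (execb_move _ _ _ _)) _ _ _ => //.
  + by rewrite /rt; lia.
  + by rewrite /s' accS; reg_eq; rewrite ?st //; lia.
  + by rewrite /s' /upd in vm *; dec_regs; lia.
- by move: b5; rewrite -[2 ^ 5]/32 => b5; nia.
Qed.

Lemma comp_expr_ok e : exists k, comp_ok e k.
Proof.
elim: e => [n|v|e [k H]|e1 [k1 H1] e2 [k2 H2]|e1 [k1 H1] e2 [k2 H2]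
  |e1 [k1 H1] e2 [k2 H2]|v e1 [k1 H1] e2 [k2 H2]].
- by exists n.+1; apply: comp_const.
- by exists 4; apply: comp_var.
- by exists (k + 4); apply: comp_bit.
- by exists (k1 + k2 + 3); apply: comp_add.
- by exists (k1 + k2 + 3); apply: comp_sub.
- by exists (k1 + k2 + (k1 + k2) + 3); apply: comp_mul.
- exact: comp_sum H1 H2.
Qed.

Lemma binaryE n : binary n = if n == 0 then [::] else odd n :: binary n./2.
Proof.
case: eqP => [->|/eqP n0]; first by [].
rewrite /binary /mkseq up_log2S ?lt0n //.
rewrite /= expn0 divn1 (iotaDl 1 0) -map_comp; congr cons.
by apply: eq_map => i /=; rewrite add1n expnS divnMA divn2.
Qed.

(** * Commands *)

Inductive cmd :=
| OutBit of bool
| OutNat of expr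
| CSeq of cmd & cmd
| CIf of expr & cmd & cmd
| For of nat & expr & cmd.

Fixpoint emit (x : seq bool) (env : nat -> nat) c : seq bool :=
  match c with
  | OutBit b => [:: b]
  | OutNat e => encode_nat (eval x env e)
  | CSeq c1 c2 => emit x env c1 ++ emit x env c2
  | CIf e c1 c2 => emit x env (if eval x env e != 0 then c1 else c2)
  | For v e c =>
      flatten [seq emit x (upd env v i) c | i <- iota 0 (eval x env e)]
  end.

(** [rt d.+4] is a parity flag: every second round increments [rt d.+3], and the final flag is the
    digit to be emitted. *)
Definition halve d :=
  Loop (rt d.+2) (IfZ (rt d.+4) (Inc (rt d.+4))
                      (Then (Dec (rt d.+4)) (Inc (rt d.+3)))).

Definition emit_digit d :=
  Then (Emit true) (Then (halve d)
  (Then (IfZ (rt d.+4) (Emit false) (Then (Dec (rt d.+4)) (Emit true)))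
        (Loop (rt d.+3) (Inc (rt d.+2))))).

(** A number has at most as many binary digits as its value, so that many rounds suffice; once
    [rt d.+2] is 0 the remaining rounds are idle. *)
Definition emit_nat d :=
  Then (Loop (rt d) (Then (Inc (rt d.+1)) (Inc (rt d.+2))))
  (Then (Loop (rt d.+1) (IfZ (rt d.+2) Skip (emit_digit d))) (Emit false)).

Fixpoint comp_cmd c d : core :=
  match c with
  | OutBit b => Emit b
  | OutNat e => Then (comp_expr e d) (emit_nat d)
  | CSeq c1 c2 => Then (comp_cmd c1 d) (comp_cmd c2 d)
  | CIf e c1 c2 => Then (comp_expr e d)
      (IfZ (rt d) (comp_cmd c2 d) (Then (Loop (rt d) Skip) (comp_cmd c1 d)))
  | For v e c => Then (comp_expr e d.+1) (for_loop v d (comp_cmd c d.+3))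
  end.

Section Commands.
Variable x : seq bool.

Lemma execb_halve d s o : clean d.+3 s -> execb x (halve d) s o
  (s (rt d.+2) * 4).+1
  (upd (upd (upd s (rt d.+2) 0) (rt d.+3) (s (rt d.+2))./2)
       (rt d.+4) (odd (s (rt d.+2)))) o.
Proof.
move=> [_ st]; set n := s (rt d.+2).
pose S m := upd (upd (upd s (rt d.+2) (n - m)) (rt d.+3) m./2) (rt d.+4) (odd m).
apply: (@execb_loop x S (fun=> o) n 3) => //.
- by move=> m _; rewrite /S; reg_val.
- move=> m mn; apply: execb_ifz.
  rewrite (_ : upd (S m) _ _ (rt d.+4) = odd m); last by rewrite /S; reg_val.
  case om: (odd m) => /=.
    apply: execb_to (execb_then (execb_dec _ _ _ _) (execb_inc _ _ _ _)) _ _ _ => //.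
    by rewrite /S /= uphalf_half om; reg_eq; lia.
  apply: execb_to (execb_inc _ _ _ _) _ _ _ => //.
  by rewrite /S /= uphalf_half om; reg_eq; lia.
- by rewrite /S subn0; reg_eq => //; rewrite st.
- by rewrite /S subnn.
Qed.

Definition digits n := flatten [seq [:: true; b] | b <- binary n].

Lemma execb_digit d s o n : clean d.+3 s -> s (rt d.+2) = n -> execb x (emit_digit d) s o
  (n * 6 + 7) (upd s (rt d.+2) n./2) (o ++ [:: true; odd n]).
Proof.
move=> cs sn; have [_ st] := cs.
pose s1 := upd (upd (upd s (rt d.+2) 0) (rt d.+3) n./2) (rt d.+4) 0.
have h : execb x (IfZ (rt d.+4) (Emit false) (Then (Dec (rt d.+4)) (Emit true)))
    (upd (upd (upd s (rt d.+2) 0) (rt d.+3) n./2) (rt d.+4) (odd n))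
    (rcons o true) 3 s1 (rcons (rcons o true) (odd n)).
  apply: execb_ifz; rewrite {1}/upd; dec_regs.
  case: (odd n) => /=.
    apply: execb_to (execb_then (execb_dec _ _ _ _) (execb_emit _ _ _ _)) _ _ _ => //.
    by rewrite /s1; reg_eq.
  by apply: execb_to (execb_emit _ _ _ _) _ _ _.
have := execb_halve (rcons o true) cs; rewrite sn => h'.
apply: execb_to (execb_then (execb_emit _ _ _ _) (execb_then h'
  (execb_then h (execb_move _ _ _ _)))) _ _ _ => //.
- by rewrite /rt; lia.
- by rewrite /s1; reg_eq; rewrite ?st //; lia.
- by rewrite -!cats1 -!catA.
- by rewrite /s1; reg_val; have := leq_half_double; lia.
Qed.

Lemma execb_digits d s o r n : n <= r -> clean d.+3 s ->
  s (rt d.+1) = r -> s (rt d.+2) = n ->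
  execb x (Loop (rt d.+1) (IfZ (rt d.+2) Skip (emit_digit d))) s o
    (r * (r * 6 + 10) + 1) (upd (upd s (rt d.+1) 0) (rt d.+2) 0) (o ++ digits n).
Proof.
elim: r n s o => [|r IH] n s o nr cs sr sn.
  have {nr} n0 : n = 0 by lia.
  apply: execb_to (execb_loop_stop _ _ _ _) _ _ _ => //.
    by reg_eq; lia.
  by rewrite n0 cats0.
have h : execb x (IfZ (rt d.+2) Skip (emit_digit d)) (upd s (rt d.+1) r) o
    (n * 6 + 8) (upd (upd s (rt d.+1) r) (rt d.+2) n./2)
    (if n == 0 then o else o ++ [:: true; odd n]).
  apply: execb_to (execb_ifz (b := n * 6 + 7) _) erefl erefl _; last by lia.
  rewrite {1}/upd; dec_regs; rewrite sn; case: eqP => n0.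
    apply: execb_to (execb_skip _ _ _) _ _ _ => //; last by lia.
    by rewrite n0; reg_eq; lia.
  apply: execb_digit; first by apply: clean_upd_rt.
  by reg_val.
apply: execb_to (execb_loop_next _ _ (IH n./2 _ _ _ _ _ _)) _ _ _.
- by rewrite sr.
- by rewrite sr; exact: h.
- by rewrite -divn2; lia.
- by do 2 apply: clean_upd_rt => //.
- by reg_val.
- by reg_val.
- by reg_eq.
- rewrite /digits (binaryE n); case: eqP => [->|_] //=.
  by rewrite -catA.
- by nia.
Qed.

Lemma execb_nat d s o n : clean d.+1 s -> s (rt d) = n ->
  execb x (emit_nat d) s o (n * (n * 6 + 13) + 3) (upd s (rt d) 0)
    (o ++ encode_nat n).
Proof.
move=> cs sn; have [_ st] := cs.
apply: execb_to (execb_then (execb_move2 _ _ _ _ _ _)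
  (execb_then (@execb_digits d _ o n n (leqnn n) _ _ _) (execb_emit _ _ _ _)))
  _ _ _; try by rewrite /rt; lia.
- do 3 (apply: clean_upd_rt; last by lia).
  by apply: clean_le cs _; lia.
- by reg_val; rewrite st // sn.
- by reg_val; rewrite st // sn.
- by reg_eq; rewrite ?st.
- by rewrite -cats1 -catA.
- by rewrite sn; nia.
Qed.

End Commands.

Definition cmd_ok c k := forall x B s d o, bounded x B s -> clean d s ->
  execb x (comp_cmd c d) s o (B ^ k) s (o ++ emit x (vars s) c).

Lemma comp_cmd_ok c : exists k, cmd_ok c k.
Proof.
elim: c => [b|e|c1 [k1 H1] c2 [k2 H2]|e c1 [k1 H1] c2 [k2 H2]|v e c [k2 H2]].
- exists 0 => x B s d o bs cs.
  by apply: execb_to (execb_emit _ _ _ _) _ _ _ => //; rewrite cats1.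
- have [k H] := comp_expr_ok e; exists (k + k + 5) => x B s d o bs cs.
  have [B2 _ _] := bs; have [_ st] := cs.
  have [v1 x1] := H x B s d o bs cs; rewrite /=.
  set n := eval _ _ _ in v1 x1 *.
  have b5 := @pow_shift B (k + k) 5 B2; rewrite expnD in b5.
  have b0 := @pow_gt0 B k B2.
  apply: execb_to (execb_then x1 (@execb_nat x d _ o n _ _)) _ _ _ => //.
  + by apply: clean_upd_rt => //; apply: clean_le cs _.
  + by reg_val.
  + by reg_eq => //; rewrite st.
  + by move: b5; rewrite -[2 ^ 5]/32 => b5; nia.
- exists (k1 + k2 + 1) => x B s d o bs cs; have [B2 _ _] := bs.
  have b1 := @leq_pow B _ _ B2 (leq_addr k2 k1).
  have b2 := @leq_pow B _ _ B2 (leq_addl k1 k2).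
  have b3 := @pow_shift B (k1 + k2) 1 B2.
  apply: execb_to (execb_then (H1 x B s d o bs cs) (H2 x B s d _ bs cs)) _ _ _ => //.
    by rewrite /= catA.
  by lia.
- have [k H] := comp_expr_ok e; exists (k + (k1 + k2) + 3) => x B s d o bs cs.
  have [B2 _ _] := bs; have [_ st] := cs.
  have [v1 x1] := H x B s d o bs cs; rewrite /=.
  set n := eval _ _ _ in v1 x1 *.
  have b3 := @pow_shift B (k + (k1 + k2)) 3 B2.
  have b0 := @pow_gt0 B (k + (k1 + k2)) B2.
  have bk : B ^ k <= B ^ (k + (k1 + k2)) by apply: leq_pow => //; lia.
  have b1 : B ^ k1 <= B ^ (k + (k1 + k2)) by apply: leq_pow => //; lia.
  have b2 : B ^ k2 <= B ^ (k + (k1 + k2)) by apply: leq_pow => //; lia.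
  apply: execb_to (execb_then x1 (execb_ifz (b := (n * 2).+1 + (B ^ k1 + B ^ k2)) _)) _ _ _;
    [|by []|by []|by lia].
  rewrite {1}/upd; dec_regs; case: eqP => n0 /=.
    rewrite n0 (_ : upd s _ _ = s); last by reg_eq => //; rewrite st.
    by apply: execb_to (H2 x B s d o bs cs) _ _ _ => //; lia.
  have sE : s = upd (upd s (rt d) n) (rt d) 0 by reg_eq => //; rewrite st.
  apply: execb_to (execb_then (execb_clear _ _ _ _) _) erefl erefl _.
    by rewrite -sE; exact: (H1 x B s d o bs cs).
  by rewrite {1}/upd; dec_regs; lia.
- have [k1 H1] := comp_expr_ok e; pose k := k1 + 1 + (k1 + 1) * k2.
  exists (k + k + 5) => x B s d o bs cs.
  have [B2 _ /(_ v) vB] := bs; have [s0 st] := cs.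
  have [v1 x1] := H1 x B s d.+1 o bs (clean_le cs (leqnSn _)); rewrite /=.
  set n1 := eval _ _ _ in v1 x1 *.
  pose B' := B ^ (k1 + 1); pose C := B' ^ k2.
  have BB : B <= B'.
    by rewrite -{1}(expn1 B) /B'; apply: leq_pow => //; lia.
  have B'2 : 2 <= B' by lia.
  have n1B : n1 <= B' by apply: leq_trans v1 _; apply: leq_pow; lia.
  pose s' m a := upd (upd (upd (upd s (rt d.+1) (n1 - m.+1)) (rt d.+2) (s (rv v)))
                    (rv v) m) (rt d) a.
  have bs' m a : m <= n1 -> bounded x B' (s' m a).
    move=> mn; apply: bounded_upd_rt; apply: bounded_upd_rv; last by lia.
    by do 2 apply: bounded_upd_rt; apply: bounded_le bs _.
  have cs' m a : clean d.+3 (s' m a).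
    apply: clean_upd_rt; last by lia.
    apply: clean_upd_rv; do 2 (apply: clean_upd_rt; last by lia).
    by apply: clean_le cs _; lia.
  have vs' m a : vars (s' m a) = upd (vars s) v m.
    by rewrite /s' vars_upd_rt vars_upd_rv !vars_upd_rt.
  have C0 : 0 < C by apply: pow_gt0.
  pose M := B' * C; have ME : M = B ^ k by rewrite /M /C /B' -expnM -expnD.
  have b5 := @pow_shift B (k + k) 5 B2; rewrite expnD -ME in b5.
  have CM : C <= M by rewrite leq_pmull //; lia.
  have BM : B' <= M by rewrite leq_pmulr.
  have bk : B ^ k1 <= B' by apply: leq_pow; lia.
  pose O m := o ++ flatten [seq emit x (upd (vars s) v i) c | i <- iota 0 m].
  have O0 : O 0 = o by rewrite /O cats0.
  rewrite -{1}O0 in x1.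
  have := @execb_for x v d (comp_cmd c d.+3) s n1 (fun=> 0) O C B cs vB erefl.
  case.
    move=> m mn; rewrite -/(s' m 0) /=.
    have := H2 x B' (s' m 0) d.+3 (O m) (bs' m 0 (ltnW mn)) (cs' m 0).
    rewrite vs' => y; apply: execb_to y _ _ _ => //.
    by rewrite /O -addn1 iotaD map_cat flatten_cat /= cats0 catA.
  move=> t tb xt; rewrite O0 in x1 xt.
  apply: execb_to (execb_then x1 (ex_intro2 _ _ t tb xt)) _ _ _ => //.
    by reg_eq => //; rewrite st.
  by move: b5; rewrite -[2 ^ 5]/32 => b5; nia.
Qed.

Theorem cmd_polytime c (f : seq bool -> seq bool) :
  (forall x, emit x (fun v => if v == 0 then size x else 0) c = f x) ->
  polytime_fun f.
Proof.
move=> cf; have [k H] := comp_cmd_ok c.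
apply: (@core_polytime f (comp_cmd c 0) k) => x.
have [||t tb et] := H x (size x + 2) (start_regs x) 0 [::].
- split; [lia | lia |] => v; rewrite /start_regs; case: ifP => _; lia.
- by split=> // i _; rewrite /start_regs ifN // /rt; lia.
exists t, (start_regs x); split=> //.
rewrite -cf; move: et; rewrite cat0s.
rewrite (_ : vars _ = fun v => if v == 0 then size x else 0) //.
apply: functional_extensionality => v; rewrite /vars /start_regs.
by rewrite (_ : (rv v == 1) = (v == 0)) // /rv; lia.
Qed.

(** * Expressible functions *)

(** Hiding the syntax behind an existential lets closure lemmas follow the mathematical form of a
    function. *)
Definition expressible (f : seq bool -> (nat -> nat) -> nat) :=
  exists e, forall x s, eval x s e = f x s.

Definition bexpressible (b : seq bool -> (nat -> nat) -> bool) :=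
  expressible (fun x s => nat_of_bool (b x s)).

Lemma expressible_ext f g : (forall x s, f x s = g x s) ->
  expressible f -> expressible g.
Proof. by move=> fg [e He]; exists e => x s; rewrite He. Qed.

Lemma expr_const n : expressible (fun _ _ => n).
Proof. by exists (EConst n). Qed.

Lemma expr_var v : expressible (fun _ s => s v).
Proof. by exists (EVar v). Qed.

Lemma expr_add f g : expressible f -> expressible g ->
  expressible (fun x s => f x s + g x s).
Proof. by move=> [a Ha] [b Hb]; exists (EAdd a b) => x s /=; rewrite Ha Hb. Qed.

Lemma expr_sub f g : expressible f -> expressible g ->
  expressible (fun x s => f x s - g x s).
Proof. by move=> [a Ha] [b Hb]; exists (ESub a b) => x s /=; rewrite Ha Hb. Qed.

Lemma expr_mul f g : expressible f -> expressible g ->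
  expressible (fun x s => f x s * g x s).
Proof. by move=> [a Ha] [b Hb]; exists (EMul a b) => x s /=; rewrite Ha Hb. Qed.

Lemma expr_succ f : expressible f -> expressible (fun x s => (f x s).+1).
Proof.
move=> Hf; apply: expressible_ext (expr_add Hf (expr_const 1)) => x s.
exact: addn1.
Qed.

Lemma expr_sum v f g : expressible f -> expressible g ->
  expressible (fun x s => \sum_(i < f x s) g x (upd s v i)).
Proof.
move=> [a Ha] [b Hb]; exists (ESum v a b) => x s /=; rewrite Ha.
by apply: eq_bigr => i _; rewrite Hb.
Qed.

Lemma expr_horner (p : {poly nat}) f : expressible f ->
  expressible (fun x s => p.[f x s]%R).
Proof.
move=> Hf; rewrite /horner; elim: (polyseq p) => [|a l IH] /=.
  exact: expr_const.
exact: expr_add (expr_mul IH Hf) (expr_const a).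
Qed.

Lemma bexpr_const b : bexpressible (fun _ _ => b).
Proof. exact: expr_const. Qed.

Lemma bexpr_bit f : expressible f -> bexpressible (fun x s => nth false x (f x s)).
Proof. by move=> [a Ha]; exists (EBit a) => x s /=; rewrite Ha. Qed.

Lemma bexpr_leq f g : expressible f -> expressible g ->
  bexpressible (fun x s => f x s <= g x s).
Proof.
move=> Hf Hg; apply: expressible_ext (expr_sub (expr_const 1) (expr_sub Hf Hg)).
by move=> x s; lia.
Qed.

Lemma bexpr_not b : bexpressible b -> bexpressible (fun x s => ~~ b x s).
Proof.
move=> Hb; apply: expressible_ext (expr_sub (expr_const 1) Hb) => x s.
by case: (b x s).
Qed.

Lemma bexpr_and b c : bexpressible b -> bexpressible c ->
  bexpressible (fun x s => b x s && c x s).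
Proof.
move=> Hb Hc; apply: expressible_ext (expr_mul Hb Hc) => x s.
by rewrite mulnb.
Qed.

Lemma bexpr_eq f g : expressible f -> expressible g ->
  bexpressible (fun x s => f x s == g x s).
Proof.
move=> Hf Hg; apply: expressible_ext (bexpr_and (bexpr_leq Hf Hg) (bexpr_leq Hg Hf)).
by move=> x s; rewrite eqn_leq.
Qed.

Lemma bexpr_or b c : bexpressible b -> bexpressible c ->
  bexpressible (fun x s => b x s || c x s).
Proof.
move=> Hb Hc.
apply: expressible_ext (bexpr_not (bexpr_and (bexpr_not Hb) (bexpr_not Hc))).
by move=> x s; case: (b x s); case: (c x s).
Qed.

Lemma bexpr_imply b c : bexpressible b -> bexpressible c ->
  bexpressible (fun x s => b x s ==> c x s).
Proof.
move=> Hb Hc; apply: expressible_ext (bexpr_or (bexpr_not Hb) Hc) => x s.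
by rewrite implybE.
Qed.

Lemma bexpr_if b c d : bexpressible b -> bexpressible c -> bexpressible d ->
  bexpressible (fun x s => if b x s then c x s else d x s).
Proof.
move=> Hb Hc Hd.
apply: expressible_ext (bexpr_or (bexpr_and Hb Hc) (bexpr_and (bexpr_not Hb) Hd)).
by move=> x s; case: (b x s); rewrite /= ?orbF.
Qed.

Lemma bexpr_app b (F : seq bool -> (nat -> nat) -> bool -> bool) :
  bexpressible b -> (forall c, bexpressible (fun x s => F x s c)) ->
  bexpressible (fun x s => F x s (b x s)).
Proof.
move=> Hb HF; apply: expressible_ext (bexpr_if Hb (HF true) (HF false)) => x s.
by case: (b x s).
Qed.

(** The list is fixed, so a lookup is a finite case distinction with a constant in each branch. In
    this way the table of a Turing machine enters an expression. *)
Lemma bexpr_nth (A : Type) (a0 : A) l f (F : seq bool -> (nat -> nat) -> A -> bool) :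
  expressible f -> (forall a, bexpressible (fun x s => F x s a)) ->
  bexpressible (fun x s => F x s (nth a0 l (f x s))).
Proof.
elim: l f => [|a l IH] f Hf HF.
  by apply: expressible_ext (HF a0) => x s; rewrite nth_nil.
apply: expressible_ext (bexpr_if (bexpr_eq Hf (expr_const 0)) (HF a)
  (IH _ (expr_sub Hf (expr_const 1)) HF)) => x s.
by case: (f x s) => [|n] //=; rewrite subn1.
Qed.

(** Division sums over an auxiliary variable, which must not be captured by the operands. *)
Lemma eval_fresh e : exists m, forall v x s i, m <= v ->
  eval x (upd s v i) e = eval x s e.
Proof.
elim: e => [n|u|e [m H]|e1 [m1 H1] e2 [m2 H2]|e1 [m1 H1] e2 [m2 H2]
  |e1 [m1 H1] e2 [m2 H2]|u e1 [m1 H1] e2 [m2 H2]].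
- by exists 0.
- by exists u.+1 => v x s i uv /=; reg_val.
- by exists m => v x s i mv /=; rewrite H.
- by exists (maxn m1 m2) => v x s i; rewrite geq_max => /andP[? ?] /=; rewrite H1 ?H2.
- by exists (maxn m1 m2) => v x s i; rewrite geq_max => /andP[? ?] /=; rewrite H1 ?H2.
- by exists (maxn m1 m2) => v x s i; rewrite geq_max => /andP[? ?] /=; rewrite H1 ?H2.
- exists (maxn u.+1 (maxn m1 m2)) => v x s i; rewrite !geq_max => /and3P[uv ? ?] /=.
  rewrite H1 //; apply: eq_bigr => j _.
  by rewrite -(H2 v x (upd s u j) i) //; congr eval; reg_eq; lia.
Qed.

Lemma sum_ltn n k : \sum_(i < n) (i < k) = minn n k.
Proof.
by elim: n => [|n IH]; [rewrite big_ord0 min0n|rewrite big_ord_recr /= IH; lia].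
Qed.

(** The quotient is the number of [i] below the dividend such that [i.+1] times the divisor does not
    exceed it. *)
Lemma expr_div f g : expressible f -> expressible g ->
  (forall x s, 0 < g x s) -> expressible (fun x s => f x s %/ g x s).
Proof.
move=> Hf Hg g0; have [a Ha] := Hf; have [b Hb] := Hg.
have [m1 Hm1] := eval_fresh a; have [m2 Hm2] := eval_fresh b.
pose m := maxn m1 m2.
apply: expressible_ext (expr_sum m Hf
  (bexpr_leq (expr_mul (expr_succ (expr_var m)) Hg) Hf)) => x s.
have fE i : f x (upd s m i) = f x s by rewrite -!Ha Hm1 // leq_maxl.
have gE i : g x (upd s m i) = g x s by rewrite -!Hb Hm2 // leq_maxr.
under eq_bigr => i _ do rewrite fE gE {1}/upd eqxx -leq_divRL //.
by rewrite sum_ltn; apply/minn_idPr/leq_div.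
Qed.

Lemma expr_mod f g : expressible f -> expressible g ->
  (forall x s, 0 < g x s) -> expressible (fun x s => f x s %% g x s).
Proof.
move=> Hf Hg g0.
apply: expressible_ext (expr_sub Hf (expr_mul (expr_div Hf Hg g0) Hg)) => x s.
by rewrite {1}(divn_eq (f x s) (g x s)) addKn.
Qed.

(** * Computation tableaux *)

Lemma horner_nat_le (p : {poly nat}) m n : m <= n -> (p.[m]%R <= p.[n]%R).
Proof.
move=> mn; rewrite /horner; elim: (polyseq p) => [|a l IH] //=.
by apply: leq_add => //; apply: leq_mul.
Qed.

(* The cell at index [j], when the head is at index [w]. *)
Definition cell_at (M : tm) w (t : tape M) j : cell M :=
  if j < w then nth None (left_of t) (w - j.+1)
  else nth None (scanned t :: right_of t) (j - w).

Lemma cell_at_head (M : tm) w (t : tape M) : cell_at w t w = scanned t.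
Proof. by rewrite /cell_at ltnn subnn. Qed.

(** Seen from the head, a move shifts the whole tape the opposite way, and the written symbol lands
    beside the head. The index [j.+1] on the left avoids a predecessor for left moves. *)
Lemma cell_at_write (M : tm) w (t : tape M) a j :
  cell_at w (write_move a t) j.+1 =
  match a.2 with
  | MoveL => if j == w then a.1 else cell_at w t j
  | MoveR => if j.+2 == w then a.1 else cell_at w t j.+2
  | Stay => if j.+1 == w then a.1 else cell_at w t j.+1
  end.
Proof.
case: t a => l c r [b []] /=; rewrite /cell_at /=.
- case: ltnP => jw.
    rewrite (ltn_trans (ltnSn j) jw) ifN; last by lia.
    by rewrite nth_behead; congr nth; lia.
  case: eqP => [<-|jw']; first by rewrite subSnn.
  case: ltnP => jw2.
    have [-> ->] : j.+1 - w = 0 /\ w - j.+1 = 0 by lia.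
    by rewrite /= nth0.
  have -> : j.+1 - w = (j - w.+1).+2 by lia.
  by have -> : j - w = (j - w.+1).+1 by lia.
- case: eqP => [<-|jw']; first by rewrite ltnSn subnn.
  case: ltnP => jw.
    rewrite ifT; last by lia.
    by have -> : w - j.+2 = (w - j.+3).+1 by lia.
  rewrite ifN; last by lia.
  rewrite (_ : j.+2 - w = (j.+1 - w).+1) /=; last by lia.
  by case: (j.+1 - w) => [|i] /=; rewrite ?nth0 ?nth_behead.
- case: eqP => [->|jw']; first by rewrite ltnn subnn.
  case: ltnP => // jw.
  by have -> : j.+1 - w = (j - w).+1 by lia.
Qed.

Lemma cell_at_input (M : tm) w x j : cell_at w (input_tape M x) j =
  if (w <= j) && (j < w + size x) then Some (inl (nth false x (j - w))) else None.
Proof.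
rewrite /cell_at /=; case: ltnP => wj /=; first by rewrite nth_nil.
have -> : nth None (head None [seq Some (inl b) | b <- x] ::
    behead [seq Some (inl b) | b <- x]) (j - w) =
    nth None ([seq Some (inl b) | b <- x] : seq (cell M)) (j - w).
  by case: x => //=; case: (j - w) => //= n; rewrite nth_nil.
case: ltnP => jx; first by rewrite (nth_map false) //; lia.
by rewrite nth_default // size_map; lia.
Qed.

Section Tableau.
Variables (M : tm) (pM pW : {poly nat}).

Notation tapeix := 'I_(extra_tapes M).+2.
Notation cellM := (option (bool + work M)).

(* The value of a tableau entry: state, scanned symbols, and on each tape the cell
   at the entry's offset from the head together with its two neighbours. *)
Definition entry : finType :=
  (state M * {ffun tapeix -> cellM} *
   ({ffun tapeix -> cellM} * {ffun tapeix -> cellM} * {ffun tapeix -> cellM}))%type.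

Definition est (o : entry) : state M := o.1.1.
Definition escan (o : entry) : {ffun tapeix -> cellM} := o.1.2.
Definition eleft (o : entry) : {ffun tapeix -> cellM} := o.2.1.1.
Definition emid (o : entry) : {ffun tapeix -> cellM} := o.2.1.2.
Definition eright (o : entry) : {ffun tapeix -> cellM} := o.2.2.

Definition tape1 : tapeix := @Ordinal (extra_tapes M).+2 1 isT.

Definition is_bit_or_blank (a : cellM) :=
  match a with Some (inr _) => false | _ => true end.

Definition wlen n : nat := pW.[n]%R.
(** The time for the longest admissible witness, so that one tableau size serves all witnesses. *)
Definition time n : nat := pM.[n + wlen n]%R.
(** Exceeding [time n] keeps border errors away from the centre column; exceeding [wlen n] keeps the
    column just behind the witness zone inside the row. *)
Definition center n := time n + wlen n + 1.
Definition width n := (center n + center n).+1.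

Definition init_ok n (x : seq bool) j (o : entry) :=
  [&& est o == start M,
      (if (center n <= j) && (j < center n + n)
       then (if nth false x (j - center n) then emid o ord0 == Some (inl true)
             else emid o ord0 == Some (inl false))
       else emid o ord0 == None),
      (if (center n <= j) && (j < center n + wlen n)
       then is_bit_or_blank (emid o tape1) else emid o tape1 == None) &
      [forall i : tapeix, (1 < i) ==> (emid o i == None)]].

Definition entry_ok n x t j (o : entry) :=
  [&& (j == center n) ==> (emid o == escan o),
      (t == 0) ==> init_ok n x j o &
      (t == time n) ==> accepting (est o)].

(* The flag requires the blank after the witness to persist to the right. *)
Definition row_ok (first : bool) (o o' : entry) :=
  [&& est o == est o', escan o == escan o', emid o == eleft o',
      eright o == emid o' &
      first ==> (emid o tape1 == None) ==> (emid o' tape1 == None)].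

(* The flags tell whether the entry receives the symbol written by the step when
   the head moves left, moves right, or stays. *)
Definition step_ok (fL fR fS : bool) (o o' : entry) :=
  if halting (est o) then (est o' == est o) && (emid o' == emid o) else
  let a := trans (est o) (escan o) in
  (est o' == a.1) && [forall i : tapeix, emid o' i ==
    match (a.2 i).2 with
    | MoveL => if fL then (a.2 i).1 else eleft o i
    | MoveR => if fR then (a.2 i).1 else eright o i
    | Stay => if fS then (a.2 i).1 else emid o i
    end].

Definition pair_ok n t j (o : entry) t' j' (o' : entry) :=
  (((t' == t) && (j' == j.+1)) ==> row_ok ((t == 0) && (center n <= j)) o o') &&
  (((t' == t.+1) && (j' == j)) ==>
     step_ok (j == (center n).+1) (j.+1 == center n) (j == center n) o o').

Definition entry0 : entry :=
  (start M, [ffun=> None], ([ffun=> None], [ffun=> None], [ffun=> None])).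

Definition decode i : entry := nth entry0 (enum entry) i.

(** The unary condition fits into a binary relation: a value that violates it conflicts with
    everything, itself included. *)
Definition conflict n (x : seq bool) p i p' i' :=
  ~~ (entry_ok n x (p %/ width n) (p %% width n) (decode i) &&
      pair_ok n (p %/ width n) (p %% width n) (decode i)
                (p' %/ width n) (p' %% width n) (decode i')).

Definition positions n := (time n).+1 * width n.

Lemma expr_wlen : expressible (fun _ s => wlen (s 0)).
Proof. exact/expr_horner/expr_var. Qed.

Lemma expr_time : expressible (fun _ s => time (s 0)).
Proof. exact/expr_horner/expr_add/expr_wlen/expr_var. Qed.

Lemma expr_center : expressible (fun _ s => center (s 0)).
Proof.
exact: expr_add (expr_add expr_time expr_wlen) (expr_const 1).
Qed.

Lemma expr_width : expressible (fun _ s => width (s 0)).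
Proof. exact/expr_succ/expr_add/expr_center/expr_center. Qed.

Lemma expr_positions : expressible (fun _ s => positions (s 0)).
Proof. exact: expr_mul (expr_succ expr_time) expr_width. Qed.

Lemma bexpr_conflict f1 f2 f3 f4 : expressible f1 -> expressible f2 ->
  expressible f3 -> expressible f4 ->
  bexpressible (fun x s => conflict (s 0) x (f1 x s) (f2 x s) (f3 x s) (f4 x s)).
Proof.
move=> H1 H2 H3 H4.
have Hw (x : seq bool) (s : nat -> nat) : 0 < width (s 0) by [].
have Ht := expr_div H1 expr_width Hw; have Hj := expr_mod H1 expr_width Hw.
have Ht' := expr_div H3 expr_width Hw; have Hj' := expr_mod H3 expr_width Hw.
have Hc := expr_center.
rewrite /conflict; apply: bexpr_not.
pose good x s o o' := entry_ok (s 0) x (f1 x s %/ width (s 0))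
    (f1 x s %% width (s 0)) o && pair_ok (s 0) (f1 x s %/ width (s 0))
    (f1 x s %% width (s 0)) o (f3 x s %/ width (s 0)) (f3 x s %% width (s 0)) o'.
(* After the two lookups [o] and [o'] are constants; what remains to be computed are comparisons of
   row and column numbers and one input bit. *)
apply: (@bexpr_nth entry entry0 (enum entry) _
  (fun x s o => good x s o (decode (f4 x s)))) => // o.
apply: (@bexpr_nth entry entry0 (enum entry) _
  (fun x s o' => good x s o o')) => // o'.
rewrite /good /entry_ok /init_ok /pair_ok.
have Hlt a b : expressible a -> expressible b ->
   bexpressible (fun x s => a x s < b x s).
  by move=> Ha Hb; apply: bexpr_leq => //; apply: expr_succ.
apply: bexpr_and.
  apply: bexpr_and; first by apply: bexpr_imply; [apply: bexpr_eq|apply: bexpr_const].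
  apply: bexpr_and; last first.
    by apply: bexpr_imply; [apply: (bexpr_eq Ht expr_time)|apply: bexpr_const].
  apply: bexpr_imply; first exact: bexpr_eq Ht (expr_const 0).
  apply: bexpr_and; first exact: bexpr_const.
  apply: bexpr_and.
    apply: bexpr_if; last exact: bexpr_const.
      apply: bexpr_and; first exact: bexpr_leq.
      by apply: Hlt => //; apply: expr_add (expr_var 0).
    apply: bexpr_if; try exact: bexpr_const.
    by apply: bexpr_bit; apply: expr_sub.
  apply: bexpr_and; last exact: bexpr_const.
  apply: bexpr_if; try exact: bexpr_const.
  apply: bexpr_and; first exact: bexpr_leq.
  by apply: Hlt => //; apply: expr_add expr_wlen.
apply: bexpr_and; apply: bexpr_imply.
- by apply: bexpr_and; apply: bexpr_eq => //; apply: expr_succ.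
- apply: (@bexpr_app _ (fun _ _ b => row_ok b o o')) => [|b].
    by apply: bexpr_and; [apply: (bexpr_eq Ht (expr_const 0))|apply: bexpr_leq].
  exact: bexpr_const.
- by apply: bexpr_and; apply: bexpr_eq => //; apply: expr_succ.
- apply: (@bexpr_app _ (fun x s b => step_ok b
     ((f1 x s %% width (s 0)).+1 == center (s 0))
     (f1 x s %% width (s 0) == center (s 0)) o o')) => [|bL].
    by apply: bexpr_eq => //; apply: expr_succ.
  apply: (@bexpr_app _ (fun x s b => step_ok bL b
     (f1 x s %% width (s 0) == center (s 0)) o o')) => [|bR].
    by apply: bexpr_eq => //; apply: expr_succ.
  apply: (@bexpr_app _ (fun x s b => step_ok bL bR b o o')) => [|bS].
    exact: bexpr_eq.
  exact: bexpr_const.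
Qed.

End Tableau.

(** * Accepting computations correspond to consistent tableaux *)

Section TableauCorrect.
Variables (M : tm) (pM pW : {poly nat}) (x : seq bool).
Notation tapeix := 'I_(extra_tapes M).+2.
Notation cellM := (option (bool + work M)).
Notation n := (size x).
Notation T := (time pM pW n).
Notation C := (center pM pW n).
Notation D := (width pM pW n).
Notation clashing := (@conflict M pM pW n x).
Notation P := (positions pM pW n).

Lemma tableau_complete w : size w <= wlen pW n ->
  let c := run M [:: x; w] pM.[n + size w]%R in
  halting c.1 -> accepting c.1 ->
  exists2 sigma : nat -> nat, (forall p, sigma p < #|entry M|) &
    forall p p', ~~ clashing p (sigma p) p' (sigma p').
Proof.
move=> wW c halt acc.
pose cf t := run M [:: x; w] t.
(* The head is put at index [C.+1], one more than its column, so that column 0 has a left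
   neighbour. *)
pose val t j : entry M := ((cf t).1, [ffun i => scanned ((cf t).2 i)],
  ([ffun i => cell_at C.+1 ((cf t).2 i) j],
   [ffun i => cell_at C.+1 ((cf t).2 i) j.+1],
   [ffun i => cell_at C.+1 ((cf t).2 i) j.+2])).
exists (fun p => index (val (p %/ D) (p %% D)) (enum (entry M))) => [p|p p'].
  by rewrite cardE index_mem mem_enum.
rewrite /conflict /decode !nth_index ?mem_enum // negbK.
move: (p %/ D) (p %% D) (p' %/ D) (p' %% D) => t j t' j' {p p'}.
have init0 i (k : nat) : cell_at C.+1 ((cf 0).2 i) k.+1 =
    let y := nth [::] [:: x; w] i in
    if (C <= k) && (k < C + size y) then Some (inl (nth false y (k - C))) else None.
  by rewrite /cf /run /= ffunE cell_at_input ltnS subSS addSn ltnS.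
apply/andP; split.
  apply/and3P; split; apply/implyP => /eqP E; rewrite ?E.
  - by apply/eqP/ffunP => i; rewrite !ffunE cell_at_head.
  - apply/and4P; split=> //; rewrite /emid /=.
    + rewrite ffunE init0 /=; case: ifP => h; rewrite h //.
      by case: (nth false x (j - C)).
    + rewrite ffunE init0 /=; case: ifP => [_|]; first by case: ifP.
      by move=> h; rewrite ifN //; move: h; case: (leqP C j) => //=; lia.
    + apply/forallP => -[[|[|i]] im] //; apply/implyP => _.
      by rewrite ffunE init0 /= nth_nil addn0 ifN //; lia.
  - rewrite /est /= /cf (@run_halted _ _ pM.[n + size w]%R) //.
    by apply: horner_nat_le; lia.
apply/andP; split; apply/implyP => /andP[/eqP -> /eqP ->].
  apply/and5P; split=> //; rewrite /emid /= !ffunE.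
  apply/implyP => /andP[/eqP -> Cj]; rewrite !init0 /=.
  apply/implyP; case: ifP => // h _; rewrite ifN //.
  by move: h; case: (leqP C j) Cj => //=; lia.
rewrite /step_ok /est /escan /emid /eleft /eright /=.
rewrite /step; case: (halting (cf t).1); first by rewrite !eqxx.
rewrite /= eqxx; apply/forallP => i; rewrite !ffunE.
by rewrite cell_at_write; apply/eqP; case: (_.2) => //; rewrite ?eqSS.
Qed.

Lemma tableau_sound (sigma : nat -> nat) :
  (forall p p', p < P -> p' < P -> ~~ clashing p (sigma p) p' (sigma p')) ->
  exists2 w, size w <= wlen pW n & accepting (run M [:: x; w] T).1.
Proof.
move=> Hs.
pose O t j := decode M (sigma (t * D + j)).
have pos t j : t <= T -> j < D -> [/\ t * D + j < P, (t * D + j) %/ D = t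
    & (t * D + j) %% D = j].
  move=> tT jD; split; last by rewrite modnMDl modn_small.
    apply: (@leq_trans (t.+1 * D)); first by rewrite mulSnr ltn_add2l.
    by rewrite leq_mul2r ltnS tT orbT.
  by rewrite divnMDl // divn_small // addn0.
have ok t j t' j' : t <= T -> j < D -> t' <= T -> j' < D ->
    entry_ok pM pW n x t j (O t j) && pair_ok pM pW n t j (O t j) t' j' (O t' j').
  move=> tT jD tT' jD'; have [p1 p2 p3] := pos t j tT jD.
  have [p1' p2' p3'] := pos t' j' tT' jD'.
  by have := Hs _ _ p1 p1'; rewrite negbK p2 p3 p2' p3'.
have CD : C < D by rewrite /width; lia.
have okU t j (tT : t <= T) (jD : j < D) := andP (ok t j t j tT jD tT jD).
have okC t : t <= T -> emid (O t C) = escan (O t C).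
  by move=> tT; have [/and3P[/implyP/(_ (eqxx _))/eqP]] := okU t C tT CD.
have okI j : j < D -> init_ok pM pW n x j (O 0 j).
  by move=> jD; have [/and3P[_ /implyP/(_ (eqxx _))]] := okU 0 j (leq0n _) jD.
have okA : accepting (est (O T C)).
  by have [/and3P[_ _ /implyP/(_ (eqxx _))]] := okU T C (leqnn _) CD.
have okR t j : t <= T -> j.+1 < D -> row_ok ((t == 0) && (C <= j)) (O t j) (O t j.+1).
  move=> tT jD; have := ok t j t j.+1 tT (ltnW jD) tT jD.
  by case/andP=> _ /andP[]; rewrite !eqxx.
have okS t j : t < T -> j < D ->
    step_ok (j == C.+1) (j.+1 == C) (j == C) (O t j) (O t.+1 j).
  move=> tT jD; have := ok t j t.+1 j (ltnW tT) jD tT jD.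
  by case/andP=> _ /andP[_]; rewrite !eqxx.
have row t j : t <= T -> j < D ->
    est (O t j) = est (O t 0) /\ escan (O t j) = escan (O t 0).
  move=> tT; elim: j => // j IH jD.
  have /and5P[/eqP <- /eqP <- _ _ _] := okR t j tT jD.
  exact: IH (ltnW jD).
have rowC t j : t <= T -> j < D ->
    est (O t j) = est (O t C) /\ escan (O t j) = emid (O t C).
  move=> tT jD; rewrite okC //; have [-> ->] := row t j tT jD.
  by have [-> ->] := row t C tT CD.
pose a i : cellM := emid (O 0 (C + i)) (tape1 M).
(* The column just behind the witness zone is blank, hence a first blank exists; its offset will be
   the length of the witness. *)
have aW : a (wlen pW n) == None.
  have wD : C + wlen pW n < D by rewrite /width /center; lia.
  by have /and4P[_ _ + _] := okI _ wD; rewrite ltnn andbF.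
have exa : exists i, a i == None by exists (wlen pW n).
pose m := ex_minn exa.
have [am mmin] : a m == None /\ forall i, a i == None -> m <= i.
  by rewrite /m; case: ex_minnP.
have mW : m <= wlen pW n by exact: mmin.
pose w := mkseq (fun i => if a i is Some (inl b) then b else false) m.
(* Before [m] the cells are bits by minimality of [m]; from [m] on they are blank because [row_ok]
   propagates blanks to the right in the first row. *)
have wE i : C + i < D -> a i = if i < m then Some (inl (nth false w i)) else None.
  move=> iD; case: ltnP => im.
    rewrite nth_mkseq //.
    have : a i != None by apply: contraTN im => /mmin; rewrite -leqNgt.
    have /and4P[_ _ + _] := okI _ iD.
    rewrite leq_addr ltn_add2l (leq_trans im mW) /=.
    by rewrite -/(a i); case: (a i) => [[]|].
  apply/eqP; move: iD; rewrite -(subnKC im); elim: (i - m) => [|k IH] kD.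
    by rewrite addn0.
  rewrite !addnS in kD; rewrite addnS; have {}IH := IH (ltnW kD).
  have /and5P[_ _ _ _] := okR 0 (C + (m + k)) (leq0n _) kD.
  by rewrite leq_addr /= -/(a _) IH /= /a !addnS.
exists w; first by rewrite size_mkseq.
pose cf t := run M [:: x; w] t.
(* Beyond this light cone the entries are not determined by the first row. *)
have main t j : t <= T -> t <= j -> j + t < D ->
    est (O t j) = (cf t).1 /\ forall i, emid (O t j) i = cell_at C ((cf t).2 i) j.
  elim: t j => [|t IH] j tT tj jD.
    have {}jD : j < D by rewrite addn0 in jD.
    have /and4P[/eqP -> xok wok rok] := okI _ jD; split=> // i.
    rewrite /cf /run /= ffunE cell_at_input.
    case: i => -[|[|i]] im /=.
    - rewrite (_ : Ordinal im = ord0); last exact: val_inj.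
      move: xok; case: ifP => h; rewrite ?h; last by move/eqP.
      by case: (nth false x (j - C)) => /eqP.
    - rewrite (_ : Ordinal im = tape1 M); last exact: val_inj.
      rewrite size_mkseq; case: (leqP C j) wok => [Cj|jC] /=; last by move=> /eqP.
      move=> _; have jE : j = C + (j - C) by rewrite subnKC.
      rewrite {1}jE -/(a (j - C)) wE -?jE //.
      by rewrite (_ : (j - C < m) = (j < C + m)) //; lia.
    - rewrite nth_nil addn0 ifN; last by lia.
      by have /forallP/(_ (Ordinal im))/eqP := rok.
  have tT' := ltnW tT.
  have CT : T < C by rewrite /center; lia.
  have jD' : j < D by lia.
  have IHj : est (O t j) = (cf t).1 /\
      forall i, emid (O t j) i = cell_at C ((cf t).2 i) j by apply: IH; lia.
  have IHl : forall i, eleft (O t j) i = cell_at C ((cf t).2 i) j.-1.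
    move=> i; have jS : j = j.-1.+1 by lia.
    have /and5P[_ _ /eqP + _ _] := okR t j.-1 tT' ltac:(lia).
    rewrite -jS => <-; apply: (IH _ tT' _ _).2; lia.
  have IHr : forall i, eright (O t j) i = cell_at C ((cf t).2 i) j.+1.
    move=> i; have /and5P[_ _ _ /eqP -> _] := okR t j tT' ltac:(lia).
    apply: (IH _ tT' _ _).2; lia.
  have IHs : escan (O t j) = [ffun i => scanned ((cf t).2 i)].
    have [_ ->] := rowC t j tT' jD'.
    apply/ffunP => i; rewrite ffunE -(cell_at_head C).
    by apply: (IH _ tT' _ _).2; rewrite /width; lia.
  have := okS t j tT jD'; rewrite /step_ok IHj.1 IHs.
  have -> : cf t.+1 = step (cf t) by [].
  rewrite /step; case: ifP => h /andP[/eqP -> ] /=.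
    by move/eqP => ->; split=> // i; exact: IHj.2.
  move/forallP => Hi; split=> // i; rewrite (eqP (Hi i)) ffunE.
  have jS : j = j.-1.+1 by lia.
  rewrite [in RHS]jS cell_at_write -jS.
  rewrite (_ : (j.-1 == C) = (j == C.+1)); last by lia.
  by case: (_.2); case: ifP => // _; first [exact: IHl|exact: IHr|exact: IHj.2].
have [<- _] := main T C (leqnn _) ltac:(rewrite /center; lia)
  ltac:(rewrite /width /center; lia).
exact: okA.
Qed.

End TableauCorrect.

(* There are [P] variables with values below [K], and [Cf n x p i p' i'] forbids giving
   value [i] to variable [p] together with value [i'] to variable [p']. *)
Lemma NP_binary_csp (L : language) : in_NP L ->
  exists (K : nat) (P : nat -> nat)
      (Cf : nat -> seq bool -> nat -> nat -> nat -> nat -> bool),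
  [/\ 0 < K, expressible (fun _ s => P (s 0)),
    (forall f1 f2 f3 f4, expressible f1 -> expressible f2 -> expressible f3 ->
      expressible f4 -> bexpressible (fun x s =>
        Cf (s 0) x (f1 x s) (f2 x s) (f3 x s) (f4 x s))) &
    forall x, L x <-> exists2 sigma : nat -> nat,
      (forall p, p < P (size x) -> sigma p < K) &
      (forall p p', p < P (size x) -> p' < P (size x) ->
         ~~ Cf (size x) x p (sigma p) p' (sigma p'))].
Proof.
case=> r [pW [[M [pM HM]] HL]].
exists #|entry M|, (positions pM pW), (@conflict M pM pW); split.
- by apply/card_gt0P; exists (entry0 M).
- exact: expr_positions.
- exact: bexpr_conflict.
move=> x; rewrite HL; split.
  case=> w wW rw; have [halt acc] := HM x w; rewrite rw in acc.
  have [sigma s1 s2] := tableau_complete wW halt acc.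
  by exists sigma => // p p' _ _; apply: s2.
case=> sigma s1 s2; have [w wW acc] := tableau_sound s2.
exists w => //; have [halt <-] := HM x w.
(* The tableau accepts at the common time bound, when the run has already been halted since its own,
   smaller bound. *)
rewrite (run_halted halt) // in acc.
by apply: horner_nat_le; rewrite leq_add2l.
Qed.

(** * Independent sets and acyclic subgraphs *)

Lemma acyclic_rank (V : finType) (D : rel V) (rk : V -> nat) :
  (forall u v, D u v -> rk u < rk v) -> acyclic D.
Proof.
move=> H [|u c] //= /(sub_path (e' := fun u v => rk u < rk v)) => /(_ H).
rewrite (@path_sortedE _ (fun u v => rk u < rk v)); last first.
  by move=> x y z; exact: ltn_trans.
by case/andP=> /allP/(_ u); rewrite mem_rcons mem_head ltnn => /(_ isT).
Qed.

Lemma acyclic_connect (V : finType) (D : rel V) u v :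
  acyclic D -> D u v -> connect D v u -> False.
Proof.
move=> acD Duv /connectP[p pth lst].
by have := acD (v :: p); rewrite /= rcons_path pth -lst Duv => /(_ isT).
Qed.

Section ConflictDigraph.
Variables (N : nat) (H : rel nat).
Notation n := (N * N.+1).

(* Vertex [(a, i)], coded by [a * N.+1 + i], is the [i]-th point of a directed path
   for [a]; the end [(b, N)] of the path for [b] has an arc to [(a, b)] whenever
   [a] and [b] conflict. *)
Definition conflict_arc u v : bool :=
  ((u %/ N.+1 == v %/ N.+1) && ((u %% N.+1).+1 == v %% N.+1)) ||
  [&& u %% N.+1 == N, v %% N.+1 == u %/ N.+1 & H (v %/ N.+1) (u %/ N.+1)].

Definition missing (D : rel 'I_n) : nat :=
  \sum_(v < n) \sum_(u < n) (conflict_arc u v && ~~ D u v).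

Lemma ltn_block v : v < n -> v %/ N.+1 < N.
Proof. by move=> vn; rewrite ltn_divLR. Qed.

(** Dropping the arc into the last point of an unselected path makes that point a source. The
    conflict arcs from selected paths lead to unselected ones only, so no cycle can close. *)
Lemma independent_acyclic (S : pred nat) :
  (forall a b, a < N -> b < N -> S a -> S b -> ~~ H a b) ->
  exists D : rel 'I_n, [/\ acyclic D, forall v, #|parents D v| <= 2 &
    missing D + #|[pred a : 'I_N | S a]| <= N].
Proof.
move=> indS.
pose cut v := (v %% N.+1 == N) && ~~ S (v %/ N.+1).
pose D : rel 'I_n := fun u v => conflict_arc u v && ~~ cut v.
(* The two candidates, the predecessor on the path and the end of the path numbered by the position
   of [v], give the in-degree bound 2. *)
have arc_parent u v : conflict_arc u v -> u = v.-1 \/ u = v %% N.+1 * N.+1 + N.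
  case/orP=> [/andP[/eqP e1 /eqP e2]|/and3P[/eqP e1 /eqP e2 _]].
    by left; rewrite (divn_eq u N.+1) (divn_eq v N.+1) e1 -e2 addnS.
  by right; rewrite e2 {1}(divn_eq u N.+1) e1.
exists D; split.
- pose rk v := if cut v then 0 else
    if S (v %/ N.+1) then (v %% N.+1).+1 else (N + v %% N.+1).+2.
  apply: (@acyclic_rank _ D (fun v => rk (val v))) => u v /andP[uv ncv].
  have un := ltn_block (ltn_ord u); have vn := ltn_block (ltn_ord v).
  rewrite /rk (negbTE ncv); case: ifP => [_|cu]; first by case: ifP.
  case/orP: uv => [/andP[/eqP e1 /eqP e2]|/and3P[/eqP e1 /eqP e2 h]].
    by rewrite e1 -e2; case: ifP; lia.
  move: cu; rewrite /cut e1 eqxx /= => /negbFE Su; rewrite Su.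
  rewrite ifN; first by lia.
  by apply/negP => Sv; have := indS _ _ vn un Sv Su; rewrite h.
- move=> v; rewrite cardE -(size_map val).
  apply: (@uniq_leq_size _ _ [:: v.-1; v %% N.+1 * N.+1 + N]).
    by rewrite map_inj_uniq ?enum_uniq //; exact: val_inj.
  move=> _ /mapP[u + ->]; rewrite mem_enum inE => /andP[uv _].
  by rewrite !inE; have [E|E] := arc_parent _ _ uv; rewrite /= E eqxx ?orbT.
(* Conflict arcs end at positions below [N], so a cut end loses its path arc and nothing else. *)
have le1 (v : 'I_n) : \sum_(u < n) (conflict_arc u v && ~~ D u v) <= cut v.
  rewrite /D; case cv: (cut v) => /=; last first.
    by rewrite big1 // => u _; rewrite andbT andbN.
  rewrite -big_mkcond /= sum1_card; apply/card_le1_eqP.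
  have arcv (u : 'I_n) : conflict_arc u v && ~~ (conflict_arc u v && false) ->
      u = v.-1 :> nat.
    rewrite andbF andbT; have un := ltn_block (ltn_ord u).
    case/orP=> [/andP[/eqP e1 /eqP e2]|/and3P[_ /eqP e2 _]].
      by rewrite (divn_eq u N.+1) (divn_eq v N.+1) e1 -e2 addnS.
    by case/andP: cv => /eqP e3 _; lia.
  by move=> u u' /arcv Eu /arcv Eu'; apply: val_inj; rewrite /= Eu Eu'.
have : missing D <= #|[pred v : 'I_n | cut v]|.
  rewrite -sum1_card big_mkcond /=; apply: leq_sum => v _.
  by apply: leq_trans (le1 v) _; rewrite inE; case: (cut v).
pose f (v : 'I_n) := Ordinal (ltn_block (ltn_ord v)).
rewrite -(@card_in_image _ _ f) =>
  [missD|u v /andP[/eqP e1 _] /andP[/eqP e2 _] /(congr1 val) /= e3].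
  rewrite -[leqRHS](card_ord N) -(cardC [pred a : 'I_N | S a]) addnC leq_add2l.
  apply: leq_trans missD _; apply: subset_leq_card; apply/subsetP => a.
  by case/imageP=> v /andP[_ h] ->.
by apply: val_inj; rewrite /= (divn_eq u N.+1) (divn_eq v N.+1) e1 e2 e3.
Qed.

(** A node is selected if all arcs entering its path, conflict arcs included, are kept. Conflicting
    selected nodes, possibly equal, would close a cycle, and each unselected node costs a missing
    arc of its own. *)
Lemma acyclic_independent (D : rel 'I_n) : symmetric H -> acyclic D ->
  exists2 S : pred nat,
    (forall a b, a < N -> b < N -> S a -> S b -> ~~ H a b) &
    N <= missing D + #|[pred a : 'I_N | S a]|.
Proof.
move=> symH acD.
pose S a := [forall v : 'I_n, (v %/ N.+1 == a) ==>
  [forall u : 'I_n, conflict_arc u v ==> D u v]].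
have lt_code a i : a < N -> i < N.+1 -> a * N.+1 + i < n.
  move=> aN iN; apply: (@leq_trans (a.+1 * N.+1)).
    by rewrite mulSnr ltn_add2l.
  by rewrite leq_mul2r aN orbT.
pose vx a i (aN : a < N) (iN : i < N.+1) : 'I_n := Ordinal (lt_code a i aN iN).
have codeD a i : i < N.+1 -> (a * N.+1 + i) %/ N.+1 = a.
  by move=> iN; rewrite divnMDl // divn_small // addn0.
have codeM a i : i < N.+1 -> (a * N.+1 + i) %% N.+1 = i.
  by move=> iN; rewrite modnMDl modn_small.
have SD a i (aN : a < N) (iN : i < N.+1) (u : 'I_n) :
    S a -> conflict_arc u (vx a i aN iN) -> D u (vx a i aN iN).
  move=> /forallP/(_ (vx a i aN iN)); rewrite /= codeD // eqxx /=.
  by move=> /forallP/(_ u)/implyP.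
exists S => [a b aN bN Sa Sb|].
  apply/negP => Hab.
  have chain c k (cN : c < N) (kN : k < N.+1) : S c ->
      connect D (vx c (N - k) cN (leq_subr k N)) (vx c N cN (ltnSn N)).
    move=> Sc; elim: k kN => [|k IH] kN.
      rewrite (_ : vx _ _ _ _ = vx c N cN (ltnSn N)) ?connect0 //.
      by apply: val_inj; rewrite /= subn0.
    apply: connect_trans (IH (ltnW kN)); apply: connect1; apply: SD => //.
    rewrite /conflict_arc /= !codeD ?codeM ?ltnS ?leq_subr // eqxx /=.
    by rewrite (_ : (N - k.+1).+1 = N - k) ?eqxx //; lia.
  have chain' c i (cN : c < N) (iN : i < N.+1) : S c ->
      connect D (vx c i cN iN) (vx c N cN (ltnSn N)).
    move=> Sc; have := chain c (N - i) cN (leq_subr i N) Sc.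
    rewrite (_ : vx _ _ _ _ = vx c i cN iN) //; apply: val_inj => /=; lia.
  have jump c d (cN : c < N) (dN : d < N) : S d -> H d c ->
      D (vx c N cN (ltnSn N)) (vx d c dN (ltnW cN)).
    move=> Sd Hdc; apply: SD => //.
    rewrite /conflict_arc /= (codeD c N) // (codeM c N) //.
    by rewrite (codeD d c (ltnW cN)) (codeM d c (ltnW cN)) !eqxx Hdc orbT.
  (* The cycle goes from [(a, N)] to [(b, a)], along the path to [(b, N)], to [(a, b)], and along
     the path back to [(a, N)]. *)
  apply: (acyclic_connect acD (jump a b aN bN Sb _)); first by rewrite symH.
  apply: connect_trans (chain' b a bN (ltnW aN) Sb) _.
  apply: connect_trans (connect1 (jump b a bN aN Sa Hab)) _.
  exact: chain'.
rewrite -[leqLHS](card_ord N) -(cardC [pred a : 'I_N | S a]) addnC leq_add2r.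
(* Missing arcs are grouped by the path they enter, so different unselected nodes are charged for
   different arcs. *)
rewrite /missing (partition_big (fun v : 'I_n => Ordinal (ltn_block (ltn_ord v)))
  xpredT) //= -sum1_card big_mkcond /=; apply: leq_sum => a _.
rewrite inE /= ; case: ifP => // /forallPn /= [v].
rewrite negb_imply => /andP[/eqP va /forallPn /= [u]]; rewrite negb_imply => uv.
rewrite (bigD1 v) /=; last by rewrite -val_eqE /= va.
by rewrite (bigD1 u) //= uv.
Qed.

End ConflictDigraph.

(** * Encodings *)

Lemma binary_inj : injective binary.
Proof.
move=> m; have [k] := ubnP m; elim: k m => // k IH m mk m'.
rewrite (binaryE m) (binaryE m'); case: eqP => [->|/eqP m0]; case: eqP => // m0'.
case=> odd_eq /IH half_eq; rewrite -(odd_double_half m) odd_eq half_eq.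
  exact: odd_double_half.
by rewrite -divn2; lia.
Qed.

(** Self-delimiting codes are prefix-free, so equal concatenations can be peeled off from the
    left. *)
Lemma encode_nat_cat m m' s s' :
  encode_nat m ++ s = encode_nat m' ++ s' -> m = m' /\ s = s'.
Proof.
rewrite /encode_nat -!catA => E.
suff [/binary_inj] : binary m = binary m' /\ s = s' by [].
elim: (binary m) (binary m') E => [|b l IH] [|b' l'] //=; first by case.
by case=> -> /IH[-> ->].
Qed.

Lemma encode_nats_cat (T : eqType) (g g' : T -> nat) l s s' :
  flatten [seq encode_nat (g y) | y <- l] ++ s =
  flatten [seq encode_nat (g' y) | y <- l] ++ s' ->
  {in l, g =1 g'} /\ s = s'.
Proof.
elim: l => //= y l IH.
rewrite -(catA (encode_nat (g y))) -(catA (encode_nat (g' y))).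
move=> /encode_nat_cat[gy /IH[gl ->]].
by split=> // z; rewrite inE => /orP[/eqP ->|/gl].
Qed.

Lemma encode_int_cat z z' s s' :
  encode_int z ++ s = encode_int z' ++ s' -> z = z' /\ s = s'.
Proof.
rewrite /encode_int /= => -[sg /encode_nat_cat[ab ->]]; split=> //.
by move: sg ab; case: z => m; case: z' => m' //=; lia.
Qed.

Lemma encode_size (n n' : nat) (f : 'I_n -> {set 'I_n} -> nat)
    (f' : 'I_n' -> {set 'I_n'} -> nat) zs zs' :
  encode f zs = encode f' zs' -> n = n'.
Proof. by move=> /encode_nat_cat[]. Qed.

(** Membership only says that some instance has the given code; this identifies it with the one that
    the reduction wrote. The diagonal is left out because the encoding omits it. *)
Lemma encode_scores n (f f' : 'I_n -> {set 'I_n} -> nat) z z' zs zs' :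
  encode f (z :: zs) = encode f' (z' :: zs') ->
  (forall v u, u != v -> f v [set u] = f' v [set u]) /\ z = z'.
Proof.
have pairs (g : 'I_n -> {set 'I_n} -> nat) :
    [seq encode_nat (g v [set u]) | v <- enum 'I_n, u <- enum (predC1 v)] =
    [seq encode_nat (g y.1 [set y.2]) |
      y <- [seq (v, u) | v <- enum 'I_n, u <- enum (predC1 v)]].
  by rewrite (map_allpairs (fun y : 'I_n * 'I_n => encode_nat (g y.1 [set y.2]))).
move=> /encode_nat_cat[_]; rewrite !pairs => /encode_nats_cat[ff /=].
move=> /encode_int_cat[-> _]; split=> // v u uv.
apply: (ff (v, u)); apply: allpairs_f_dep; first by rewrite mem_enum.
by rewrite mem_enum.
Qed.

Lemma flatten_allpairs_neq n (g : nat -> nat -> seq bool) :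
  flatten [seq g (nat_of_ord v) (nat_of_ord u)
          | v <- enum 'I_n, u <- enum (predC1 v)] =
  flatten [seq flatten [seq if i != j then g i j else [::] | j <- iota 0 n]
          | i <- iota 0 n].
Proof.
have inner (v : 'I_n) : flatten [seq g v (nat_of_ord u) | u <- enum (predC1 v)] =
    flatten [seq if val v != j then g v j else [::] | j <- iota 0 n].
  rewrite -val_enum_ord -map_comp.
  have -> : enum (predC1 v) = [seq u <- enum 'I_n | u != v].
    rewrite {1}/enum_mem -filter_predI.
    by apply: eq_filter => u; rewrite !inE andbT.
  elim: (enum 'I_n) => //= u l IH; rewrite eq_sym -val_eqE /=.
  by case: (val v == val u); rewrite /= ?IH //.
pose h i := flatten [seq if i != j then g i j else [::] | j <- iota 0 n].
suff outer (l : seq 'I_n) : flatten [seq g (nat_of_ord v) (nat_of_ord u)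
    | v <- l, u <- enum (predC1 v)] = flatten [seq h i | i <- map val l].
  by rewrite outer val_enum_ord.
by elim: l => //= v l IH; rewrite flatten_cat inner IH.
Qed.

(** * The reduction *)

Section Reduction.
Variables (K : nat) (P : nat -> nat).
Variable Cf : nat -> seq bool -> nat -> nat -> nat -> nat -> bool.
Hypothesis K0 : 0 < K.

Definition nodes n := P n * K.
Definition vertices n := nodes n * (nodes n).+1.

(* Node [p * K + i] stands for giving value [i] to variable [p]. *)
Definition clash n x a b :=
  [|| (a %/ K == b %/ K) && (a != b),
      Cf n x (a %/ K) (a %% K) (b %/ K) (b %% K) |
      Cf n x (b %/ K) (b %% K) (a %/ K) (a %% K)].

Lemma clash_sym n x : symmetric (clash n x).
Proof.
by move=> a b; rewrite /clash eq_sym (eq_sym a); congr orb; rewrite orbC.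
Qed.

Definition weight n x u v := conflict_arc (nodes n) (clash n x) u v.

Definition total n x : nat :=
  \sum_(v < vertices n) \sum_(u < vertices n) weight n x u v.

(** Reaching it means missing at most [nodes n - P n] arcs. Truncated subtraction preserves this
    equivalence, since score and missing arcs add up to [total n x]. *)
Definition threshold n x := total n x - (nodes n - P n).

Definition scores n x (v : 'I_(vertices n)) (Q : {set 'I_(vertices n)}) : nat :=
  \sum_(u in Q) weight n x u v.
Arguments scores : clear implicits.

Lemma additive_scores n x : additive (scores n x).
Proof.
by move=> v Q _; apply: eq_bigr => u _; rewrite /scores big_set1.
Qed.

Lemma score_missing n x (D : rel 'I_(vertices n)) :
  score (scores n x) D + missing (clash n x) D = total n x.
Proof.
rewrite /score /missing -big_split /=; apply: eq_bigr => v _.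
rewrite /scores big_mkcond -big_split /=; apply: eq_bigr => u _.
by rewrite inE /weight; case: (D u v); case: conflict_arc.
Qed.

Definition satisfiable n x := exists2 sigma : nat -> nat,
  (forall p, p < P n -> sigma p < K) &
  (forall p p', p < P n -> p' < P n -> ~~ Cf n x p (sigma p) p' (sigma p')).

Lemma ltn_node n a : a < nodes n -> a %/ K < P n.
Proof. by move=> aN; rewrite ltn_divLR. Qed.

Lemma satisfiable_independent n x : satisfiable n x ->
  exists2 S : pred nat,
    (forall a b, a < nodes n -> b < nodes n -> S a -> S b -> ~~ clash n x a b) &
    P n <= #|[pred a : 'I_(nodes n) | S a]|.
Proof.
case=> sigma sK sC; exists (fun a => a %% K == sigma (a %/ K)).
  move=> a b aN bN /eqP Sa /eqP Sb; rewrite /clash !negb_or Sa Sb !sC ?ltn_node //.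
  rewrite !andbT; case: eqP => //= E.
  by rewrite negbK (divn_eq a K) (divn_eq b K) Sa Sb E.
have lt (p : 'I_(P n)) : p * K + sigma p < nodes n.
  apply: (@leq_trans (p.+1 * K)); first by rewrite mulSnr ltn_add2l sK.
  by rewrite leq_mul2r ltn_ord orbT.
have dE (p : 'I_(P n)) : (p * K + sigma p) %/ K = p.
  by rewrite divnMDl // divn_small ?sK // addn0.
rewrite -[leqLHS]card_ord -(card_codom (f := fun p => Ordinal (lt p))).
  apply: subset_leq_card; apply/subsetP => _ /codomP[p ->].
  by rewrite inE /= dE modnMDl modn_small ?sK.
by move=> p q /(congr1 val) /= E; apply: val_inj; rewrite /= -(dE p) E dE.
Qed.

(** Different values of one variable clash, so an independent set has at most one node per variable,
    and with [P n] nodes it meets every variable. *)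
Lemma independent_satisfiable n x (S : pred nat) :
  (forall a b, a < nodes n -> b < nodes n -> S a -> S b -> ~~ clash n x a b) ->
  P n <= #|[pred a : 'I_(nodes n) | S a]| -> satisfiable n x.
Proof.
move=> indS PS; pose f (a : 'I_(nodes n)) := Ordinal (ltn_node (ltn_ord a)).
have finj : {in [pred a : 'I_(nodes n) | S a] &, injective f}.
  move=> a b Sa Sb /(congr1 val) /= E; apply: val_inj; apply/eqP => /=.
  have := indS a b (ltn_ord a) (ltn_ord b) Sa Sb.
  by rewrite /clash E eqxx /= !negb_or negbK => /andP[].
have full : f @: [pred a : 'I_(nodes n) | S a] = [set: 'I_(P n)].
  by apply/eqP; rewrite eqEcard subsetT cardsT card_ord card_in_imset.
have ex p : p < P n -> exists a, [&& a < nodes n, S a & a %/ K == p].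
  move=> pP; have : Ordinal pP \in [set: 'I_(P n)] by rewrite inE.
  rewrite -full => /imsetP[a Sa /(congr1 val) /= E].
  by exists a; rewrite ltn_ord E eqxx andbT.
(* Matching on [idP] supplies the proof of [p < P n] on which [xchoose] depends; 0 is a dummy value
   elsewhere. *)
pose sigma p := if @idP (p < P n) is ReflectT h then xchoose (ex p h) %% K else 0.
have sP p : p < P n -> exists2 a, [&& a < nodes n, S a & a %/ K == p] & sigma p = a %% K.
  rewrite /sigma; case: {-}_ / idP => // h _.
  by exists (xchoose (ex p h)) => //; exact: (xchooseP (ex p h)).
exists sigma => [p /sP[a _ ->]|p p' /sP[a /and3P[aN Sa /eqP <-] ->]
    /sP[b /and3P[bN Sb /eqP <-] ->]]; first by rewrite ltn_mod.
by have := indS a b aN bN Sa Sb; rewrite /clash !negb_or => /and3P[].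
Qed.

Lemma satisfiable_acyclic n x : satisfiable n x ->
  exists D : rel 'I_(vertices n), [/\ acyclic D, forall v, #|parents D v| <= 2 &
    threshold n x <= score (scores n x) D].
Proof.
case/satisfiable_independent=> S indS PS.
have [D [acD deg mis]] := independent_acyclic indS; exists D; split=> //.
by have := score_missing x D; rewrite /threshold; lia.
Qed.

Lemma acyclic_satisfiable n x (D : rel 'I_(vertices n)) : acyclic D ->
  threshold n x <= score (scores n x) D -> satisfiable n x.
Proof.
move=> acD sc; have [S indS mis] := acyclic_independent (clash_sym n x) acD.
apply: independent_satisfiable indS _.
have PN : P n <= nodes n by rewrite leq_pmulr.
by have := score_missing x D; rewrite /threshold in sc; lia.
Qed.

End Reduction.
Arguments scores : clear implicits.

Section ReductionComputable.
Variables (K : nat) (P : nat -> nat).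
Variable Cf : nat -> seq bool -> nat -> nat -> nat -> nat -> bool.
Hypothesis K0 : 0 < K.
Hypothesis exprP : expressible (fun _ s => P (s 0)).
Hypothesis bexprC : forall f1 f2 f3 f4, expressible f1 -> expressible f2 ->
  expressible f3 -> expressible f4 ->
  bexpressible (fun x s => Cf (s 0) x (f1 x s) (f2 x s) (f3 x s) (f4 x s)).

Notation nodes := (nodes K P).
Notation vertices := (vertices K P).
Notation threshold := (threshold K P Cf).

Lemma expr_nodes : expressible (fun _ s => nodes (s 0)).
Proof. exact: expr_mul exprP (expr_const K). Qed.

Lemma expr_vertices : expressible (fun _ s => vertices (s 0)).
Proof. exact: expr_mul expr_nodes (expr_succ expr_nodes). Qed.

(** Variable 0 holds the input length, variable 1 the head and variable 2 the tail of the arc, in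
    the nesting order of the sums in [total]. *)
Lemma bexpr_weight : bexpressible (fun x s => weight K P Cf (s 0) x (s 2) (s 1)).
Proof.
have N0 (x : seq bool) (s : nat -> nat) : 0 < (nodes (s 0)).+1 by [].
have K0' (x : seq bool) (s : nat -> nat) : 0 < K by [].
have HN := expr_succ expr_nodes.
have da := expr_div (expr_var 1) HN N0; have ma := expr_mod (expr_var 1) HN N0.
have db := expr_div (expr_var 2) HN N0; have mb := expr_mod (expr_var 2) HN N0.
have HK := expr_const K.
rewrite /weight /conflict_arc /clash.
apply: bexpr_or.
  apply: bexpr_and; first exact: bexpr_eq.
  exact: bexpr_eq (expr_succ mb) ma.
apply: bexpr_and; first exact: bexpr_eq mb expr_nodes.
apply: bexpr_and; first exact: bexpr_eq.
apply: bexpr_or.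
  apply: bexpr_and; last by apply: bexpr_not; apply: bexpr_eq.
  by apply: bexpr_eq; apply: expr_div.
by apply: bexpr_or; apply: bexprC; first [exact: expr_div | exact: expr_mod].
Qed.

Lemma expr_threshold : expressible (fun x s => threshold (s 0) x).
Proof.
apply: expr_sub; last exact: expr_sub expr_nodes exprP.
exact: (expr_sum 1 expr_vertices (expr_sum 2 expr_vertices bexpr_weight)).
Qed.

(** The empty loop serves as a no-op, and the bit [false] is the sign of a nonnegative integer. *)
Definition constants_cmd (ms : seq nat) : cmd :=
  foldr (fun m c => CSeq (OutBit false) (CSeq (OutNat (EConst m)) c))
        (For 0 (EConst 0) (OutBit false)) ms.

Lemma emit_constants x s ms : emit x s (constants_cmd ms) =
  flatten [seq encode_int (Posz m) | m <- ms].
Proof. by elim: ms => //= m ms ->. Qed.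

Lemma polytime_instance (ms : seq nat) : polytime_fun (fun x =>
  encode (scores K P Cf (size x) x)
    (Posz (threshold (size x) x) :: [seq Posz m | m <- ms])).
Proof.
have [en Hn] := expr_vertices; have [ew Hw] := bexpr_weight.
have [et Ht] := expr_threshold.
have [ed Hd] := bexpr_eq (expr_var 1) (expr_var 2).
(* The conditional skips the diagonal, which [encode] omits; the [OutBit false] before the threshold
   is its sign. *)
apply: (@cmd_polytime (CSeq (OutNat en)
  (CSeq (For 1 en (For 2 en (CIf ed (For 0 (EConst 0) (OutBit false)) (OutNat ew))))
  (CSeq (OutBit false) (CSeq (OutNat et) (constants_cmd ms)))))) => x.
rewrite /= emit_constants !Hn !Ht /= /encode; congr cat.
have -> : [seq encode_nat (scores K P Cf (size x) x v [set u])
     | v <- enum 'I_(vertices (size x)), u <- enum (predC1 v)] =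
  [seq encode_nat (weight K P Cf (size x) x (nat_of_ord u) (nat_of_ord v))
     | v <- enum 'I_(vertices (size x)), u <- enum (predC1 v)].
  by apply: eq_allpairs => v u; rewrite /scores big_set1.
congr cat; last by rewrite /= -map_comp.
apply: etrans (esym (flatten_allpairs_neq _
  (fun i j => encode_nat (weight K P Cf (size x) x j i)))).
congr flatten; apply: eq_map => i; rewrite Hn /=.
congr flatten; apply: eq_map => j; rewrite Hd /upd /=.
by case: (i == j); rewrite /= ?Hw.
Qed.

Lemma instance_sound x n' (f' : 'I_n' -> {set 'I_n'} -> nat) l' zs zs'
    (D : rel 'I_n') :
  additive f' ->
  encode (scores K P Cf (size x) x) (Posz (threshold (size x) x) :: zs) =
    encode f' (l' :: zs') ->
  acyclic D -> (l' <= Posz (score f' D))%R -> satisfiable K P Cf (size x) x.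
Proof.
move=> addf E; have En := encode_size E; subst n'.
have [ff <-] := encode_scores E; move=> acD.
(* Both score functions are additive and agree off the diagonal; acyclicity keeps [v] out of its own
   parent set, so no junk value enters. *)
have -> : score f' D = score (scores K P Cf (size x) x) D.
  apply: eq_bigr => v _.
  have vD : v \notin parents D v.
    by apply/negP; rewrite inE => Dv; have := acD [:: v]; rewrite /= Dv => /(_ isT).
  rewrite addf // additive_scores //; apply: eq_bigr => u uD; rewrite ff //.
  by apply: contraNneq vD => uv; rewrite -{1}uv.
by rewrite lez_nat => h; exact: acyclic_satisfiable acD h.
Qed.

End ReductionComputable.

Theorem theorem6 :
  NP_hard BNSL_plus /\
  forall q : int, (3 <= q)%R -> NP_hard (BNSL_plus_le q).
Proof.
split=> [L /NP_binary_csp|q q3 L /NP_binary_csp];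
  case=> K [P [Cf [K0 exprP bexprC HL]]].
  exists (fun x => encode (scores K P Cf (size x) x)
    [:: Posz (threshold K P Cf (size x) x)]); split.
    exact: (polytime_instance K0 exprP bexprC [::]).
  move=> x; rewrite HL; split.
    move=> /(satisfiable_acyclic K0)[D [acD _ sc]].
    exists (vertices K P (size x)), (scores K P Cf (size x) x),
      (Posz (threshold K P Cf (size x) x)).
    by split=> //; [apply: additive_scores|exists D].
  case=> n' [f' [l' [addf E [D [acD sc]]]]].
  exact: instance_sound addf E acD sc.
have qE : q = Posz `|q|%N by lia.
exists (fun x => encode (scores K P Cf (size x) x)
  [:: Posz (threshold K P Cf (size x) x); q]); split.
  rewrite qE; exact: (polytime_instance K0 exprP bexprC [:: `|q|%N]).
move=> x; rewrite HL; split.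
  move=> /(satisfiable_acyclic K0)[D [acD deg sc]].
  exists (vertices K P (size x)), (scores K P Cf (size x) x),
    (Posz (threshold K P Cf (size x) x)).
  split=> //; [exact: additive_scores|exists D; split=> // v].
  by have := deg v; lia.
case=> n' [f' [l' [addf E [D [acD _ sc]]]]].
exact: instance_sound addf E acD sc.
Qed.
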